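(* Suppose (a) $\mathcal{V}(X\mid Y)$ is bounded away from zero almost surely (there is $c>0$ with $\mathcal{V}(X\mid Y)\ge c$ a.s.), and (b) $\mathcal{T}(X\mid Y)$ is bounded away from infinity almost surely (there is $C<\infty$ with $\mathcal{T}(X\mid Y)\le C$ a.s.). Then for every $0\le\varepsilon\le1$, $$L^*_{\max}(n,\varepsilon,X,Y) = n(1-\varepsilon)H(X\mid Y) - \sqrt{n\,V_{\mathrm c}(X\mid Y)}\,f_{\mathrm G}(\varepsilon) + O(\log n)\quad (n\to\infty).$$
   Context: Setting: $\mathcal{X}=\{1,2,\dots\}$ with its power set, $\mathcal{Y}$ an arbitrary measurable space, $X$ an $\mathcal{X}$-valued and $Y$ a $\mathcal{Y}$-valued random variable. Logarithms are base 2. $P_{X|Y}(x\mid Y)$ is a version of $\mathbb{P}\{X=x\mid Y\}$; $\iota(X\mid Y):=\log(1/P_{X|Y}(X\mid Y))$. Define the $\sigma(Y)$-measurable quantities $\mathcal{H}(X\mid Y):=\mathbb{E}[\iota(X\mid Y)\mid Y]$, $\mathcal{V}(X\mid Y):=\mathbb{E}[(\iota(X\mid Y)-\mathcal{H}(X\mid Y))^2\mid Y]$, $\mathcal{T}(X\mid Y):=\mathbb{E}[|\iota(X\mid Y)-\mathcal{H}(X\mid Y)|^3\mid Y]$, and the numbers $H(X\mid Y):=\mathbb{E}[\mathcal{H}(X\mid Y)]$, $V_{\mathrm c}(X\mid Y):=\mathbb{E}[\mathcal{V}(X\mid Y)]$. $(X_i,Y_i)$, $i=1,\dots,n$, are i.i.d.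 copies of $(X,Y)$, $X^n=(X_1,\dots,X_n)$, $Y^n=(Y_1,\dots,Y_n)$. $\varphi(t)=e^{-t^2/2}/\sqrt{2\pi}$, $\Phi$ the standard Gaussian CDF, $f_{\mathrm G}(s):=\varphi(\Phi^{-1}(s))$ for $0<s<1$ and $f_{\mathrm G}(0)=f_{\mathrm G}(1)=0$. Codes: $\{0,1\}^*$ is the set of finite binary strings including the empty string $\varnothing$, and $\ell(\mathbf b)$ is the length of $\mathbf b$. A variable-length stochastic code is a pair of random (possibly randomized) maps $F_n:\mathcal X^n\times\mathcal Y^n\to\{0,1\}^*$, $G_n:\{0,1\}^*\times\mathcal Y^n\to\mathcal X^n$ such that $F_n(X^n,Y^n)$ and $G_n(F_n(X^n,Y^n),Y^n)$ are random variables. It is an $(n,L,\varepsilon)_{\max}$-code if $\mathbb{E}[\ell(F_n(X^n,Y^n))]\le L$ and $\mathbb{P}\{X^n\ne G_n(F_n(X^n,Y^n),Y^n)\mid Y^n\}\le\varepsilon$ a.s. $L^*_{\max}(n,\varepsilon,X,Y):=\inf\{L>0:\text{an }(n,L,\varepsilon)_{\max}\text{-code exists}\}$. *)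

(* Defs.v *)
From HB Require Import structures.
From mathcomp Require Import all_boot all_order all_algebra.
From mathcomp Require Import all_classical all_reals all_analysis.
Set Implicit Arguments. Unset Strict Implicit. Unset Printing Implicit Defensive.
Import Order.TTheory GRing.Theory Num.Theory.
Import numFieldNormedType.Exports.
Local Open Scope classical_set_scope.
Local Open Scope ring_scope.

Definition log2 {R : realType} (x : R) : R := ln x / ln 2.

Definition gphi {R : realType} (t : R) : R := normal_pdf 0 1 t.
Definition gPhi {R : realType} (t : R) : R := fine (normal_prob 0 1 `]-oo, t]).
(* Phi^{-1}(s): the (unique, for 0<s<1) t with Phi t = s *)
Definition gPhi_inv {R : realType} (s : R) : R := [get t | gPhi t = s].
Definition fG {R : realType} (s : R) : R :=
  if (0 < s) && (s < 1) then gphi (gPhi_inv s) else 0.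

Section Source.
Context {R : realType} {d : measure_display} {TY : measurableType d}.
Local Open Scope ereal_scope.

(* p x y = P_{X|Y}(x | y): a regular version of the conditional pmf of the
   N-valued X given Y = y.  The joint law of (X,Y) is  P_Y(dy) p(x|y). *)
Definition cond_pmf (p : nat -> TY -> R) : Prop :=
  [/\ (forall x y, (0 <= p x y)%R),
      (forall y, \esum_(x in [set: nat]) (p x y)%:E = 1) &
      (forall x, measurable_fun [set: TY] (p x))].

Definition iota (p : nat -> TY -> R) (x : nat) (y : TY) : R := log2 (1 / p x y).

Definition condH (p : nat -> TY -> R) (y : TY) : \bar R :=
  \esum_(x in [set: nat]) (p x y * iota p x y)%:E.

Definition condV (p : nat -> TY -> R) (y : TY) : \bar R :=
  \esum_(x in [set: nat])
     ((p x y)%:E * (((iota p x y)%:E - condH p y) * ((iota p x y)%:E - condH p y))).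

Definition condT (p : nat -> TY -> R) (y : TY) : \bar R :=
  \esum_(x in [set: nat])
     ((p x y)%:E * (`|(iota p x y)%:E - condH p y| *
                    `|(iota p x y)%:E - condH p y| *
                    `|(iota p x y)%:E - condH p y|)).

Definition Hc (PY : probability TY R) (p : nat -> TY -> R) : \bar R :=
  \int[PY]_y condH p y.
Definition Vc (PY : probability TY R) (p : nat -> TY -> R) : \bar R :=
  \int[PY]_y condV p y.

(* iterated integral w.r.t. the product probability P_Y^{(x) n} on Y^n *)
Fixpoint iint (PY : probability TY R) (n : nat) :
    (n.-tuple TY -> \bar R) -> \bar R :=
  match n return (n.-tuple TY -> \bar R) -> \bar R with
  | 0 => fun g => g [tuple]
  | m.+1 => fun g => \int[PY]_y iint PY (fun t : m.-tuple TY => g (cons_tuple y t))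
  end.

Definition ae_n (PY : probability TY R) (n : nat) (Q : n.-tuple TY -> Prop) : Prop :=
  exists N : set (n.-tuple TY), [/\ measurable N,
     iint PY (fun t => (\1_N t)%:E) = 0 & ~` [set t | Q t] `<=` N].

Definition pn (p : nat -> TY -> R) n (xs : n.-tuple nat) (ys : n.-tuple TY) : R :=
  (\prod_(i < n) p (tnth xs i) (tnth ys i))%R.

(* enc xs ys b = probability that the stochastic encoder F_n outputs the
   binary string b on input (xs, ys);
   dec b ys xh = probability that the stochastic decoder G_n outputs xh on
   input (b, ys).  Measurability in ys makes F_n(X^n,Y^n), G_n(..) random
   variables. *)
Definition is_code n (enc : n.-tuple nat -> n.-tuple TY -> seq bool -> R)
    (dec : seq bool -> n.-tuple TY -> n.-tuple nat -> R) : Prop :=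
  [/\ (forall xs ys b, (0 <= enc xs ys b)%R),
      (forall xs ys, \esum_(b in [set: seq bool]) (enc xs ys b)%:E = 1) &
      (forall xs b, measurable_fun [set: n.-tuple TY] (fun ys => enc xs ys b))] /\
  [/\ (forall b ys xh, (0 <= dec b ys xh)%R),
      (forall b ys, \esum_(xh in [set: n.-tuple nat]) (dec b ys xh)%:E = 1) &
      (forall b xh, measurable_fun [set: n.-tuple TY] (fun ys => dec b ys xh))].

Definition exp_len (PY : probability TY R) (p : nat -> TY -> R) n
    (enc : n.-tuple nat -> n.-tuple TY -> seq bool -> R) : \bar R :=
  iint PY (fun ys => \esum_(xs in [set: n.-tuple nat]) \esum_(b in [set: seq bool])
      (pn p xs ys * enc xs ys b * (size b)%:R)%:E).

Definition cond_err (p : nat -> TY -> R) n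
    (enc : n.-tuple nat -> n.-tuple TY -> seq bool -> R)
    (dec : seq bool -> n.-tuple TY -> n.-tuple nat -> R) (ys : n.-tuple TY) : \bar R :=
  \esum_(xs in [set: n.-tuple nat]) \esum_(b in [set: seq bool])
      (pn p xs ys * enc xs ys b * (1 - dec b ys xs))%:E.

Definition Lstar_max (PY : probability TY R) (p : nat -> TY -> R) (n : nat) (eps : R)
    : \bar R :=
  ereal_inf [set L%:E | L in [set L : R | (0 < L)%R /\
     exists (enc : n.-tuple nat -> n.-tuple TY -> seq bool -> R)
            (dec : seq bool -> n.-tuple TY -> n.-tuple nat -> R),
       [/\ is_code enc dec, exp_len PY p enc <= L%:E &
        ae_n PY (fun ys => cond_err p enc dec ys <= eps%:E)]]].

End Source.

(* Main.v *)
(* Fix the side information [ys].  The information [Z] of the block is then a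
   sum of independent terms with mean [H] and variance [V], and both directions
   reduce to the value of [E q(Z) Z] over tests [q] of mean [1 - eps].  By
   linear programming duality this value is the maximum over [s] of
   [(1 - eps) H + eps s - E (s + Z - H)^+].  A Lindeberg exchange compares
   [E (s + Z - H)^+] with [U(sqrt V, s) = E (s + sqrt V G)^+], [G] Gaussian: for
   this explicit [U] exchanging one term costs O(1 / remaining variance), so the
   total error is a harmonic sum, O(log n), and no Berry-Esseen theorem is
   needed.  The maximum over [s] of [eps s - U(r, s)] is [- r fG(eps)].

   Achievability: keep the most likely blocks, randomizing on the last dyadic
   shell of probabilities, and number the blocks of the shell
   [2^-m <= P < 2 * 2^-m] by strings of length exactly [m].  Converse: a Gibbs
   inequality against the measure [2^-l(b) (n / (n+1))^|l(b) - H|] on strings,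
   of total mass O(n), gives [l >= Z - O(log n)] in the mean on the event of
   correct decoding.  Averaging over [ys] replaces [E sqrt (V(Y^n))] by
   [sqrt (n Vc)] up to O(log n), again by one-step exchanges. *)
Require Import Defs.
From HB Require Import structures.
From mathcomp Require Import all_boot all_order all_algebra.
From mathcomp Require Import all_classical all_reals all_analysis.
From mathcomp Require Import measurable_realfun ring lra.
Import Order.TTheory GRing.Theory Num.Theory.
Import numFieldNormedType.Exports.
Local Open Scope classical_set_scope.
Local Open Scope ring_scope.
Local Notation iota := Defs.iota.

(** * Gaussian expectation of the positive part *)

Section gauss.
Context {R : realType}.
Implicit Types s x r w : R.
Notation mu := (@lebesgue_measure R).

(** The hypotheses do not bound the entropy: [condH] is finite almost everywhere, but [Hc] may be
    infinite, and sums and integrals add freely only on nonnegative terms. Signed quantities are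
    therefore rewritten with their negative part on the other side, and approximations come as pairs
    [A <= B + err], [B <= A + err] rather than as bounds on [A - B]. The positive part is not
    smooth, so a Gaussian of variance 1 is added before any exchange; this is the 1 under the root
    in [sdev]. While k letters are still smoothed the variance is at least 1 + c k, which is where
    the lower bound on the conditional variance enters. The third derivative of U in s is of the
    order of the inverse variance, and U solves a heat equation, so the second order terms of the
    two sides of an exchange cancel. The third moment bounds the variance as well, so one constant
    serves every exchange. In the direct part the cutoff is forced by the mass to be kept and cannot
    be tuned. This does no harm: the tangent inequality for U holds at every s, hence at the s that
    the cutoff produces. *)

Definition is_derive_continuous (f df : R -> R)
  (h : forall x, is_derive x 1 f (df x)) : continuous f.
Proof.
move=> x; apply: differentiable_continuous; apply/derivable1_diffP.
by have := h x; case.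
Qed.

(** The intermediate point is located by its distance to [a], so that [a] and [b] may come in either
    order; Taylor increments below have both signs. *)
Lemma mean_value (f df : R -> R) (h : forall x, is_derive x 1 f (df x)) a b :
  exists2 c, `|c - a| <= `|b - a| & f b - f a = df c * (b - a).
Proof.
have cf := is_derive_continuous _ _ h.
have [ab|ba] := leP a b.
  have [c] := MVT_segment ab (fun x _ => h x) (continuous_subspaceT cf).
  rewrite in_itv/= => /andP[ac cb] e; exists c => //.
  by rewrite !ger0_norm ?subr_ge0// lerB.
have [c] := MVT_segment (ltW ba) (fun x _ => h x) (continuous_subspaceT cf).
rewrite in_itv/= => /andP[bc ca] e; exists c; last first.
  by rewrite -[LHS]opprB e; ring.
rewrite !(distrC _ a) !ger0_norm ?subr_ge0 //; last exact: ltW.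
by rewrite lerD2l lerN2.
Qed.

Lemma mean_value_itv (f df : R -> R) a b : a <= b ->
  (forall x, a <= x <= b -> is_derive x 1 f (df x)) ->
  exists2 c, a <= c <= b & f b - f a = df c * (b - a).
Proof.
move=> ab h; have [//| |c] := @MVT_segment _ f df a b ab.
- by move=> x; rewrite in_itv/= => /andP[? ?]; apply: h; rewrite !ltW.
- apply: derivable_within_continuous => x; rewrite in_itv/= => ?.
  by have [] := h x _.
- by rewrite in_itv/=; exists c.
Qed.

Lemma derive_ge0_le (f df : R -> R) (h : forall x, is_derive x 1 f (df x)) a b :
  a <= b -> (forall x, a <= x <= b -> 0 <= df x) -> f a <= f b.
Proof.
move=> ab p.
have [c] := MVT_segment ab (fun x _ => h x) (continuous_subspaceT (is_derive_continuous _ _ h)).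
rewrite in_itv/= => /p ? e.
by rewrite -subr_ge0 e mulr_ge0// subr_ge0.
Qed.

(** The mean value theorem is applied three times, to [f2], to [f1] minus its linear part and to [f]
    minus its quadratic part. This loses the factor 1/6, which is harmless. *)
Lemma taylor2_bound (f f1 f2 f3 : R -> R) (M : R) :
  (forall x, is_derive x 1 f (f1 x)) -> (forall x, is_derive x 1 f1 (f2 x)) ->
  (forall x, is_derive x 1 f2 (f3 x)) -> (forall x, `|f3 x| <= M) ->
  forall s x, `|f (s + x) - f s - x * f1 s - x ^+ 2 / 2 * f2 s| <= M * `|x| ^+ 3.
Proof.
move=> h1 h2 h3 hM s x.
have M0 : 0 <= M by apply: le_trans (hM 0).
have b2 y : `|f2 (s + y) - f2 s| <= M * `|y|.
  have [c _ ->] := mean_value _ _ h3 s (s + y).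
  by rewrite (addrC s) addrK normrM ler_wpM2r.
have b1 y : `|f1 (s + y) - f1 s - y * f2 s| <= M * `|y| ^+ 2.
  pose g z := f1 z - z * f2 s.
  have hg (z : R) : is_derive z 1 g (f2 z - f2 s).
    by apply: is_derive_eq; rewrite /GRing.scale/=; ring.
  have -> : f1 (s + y) - f1 s - y * f2 s = g (s + y) - g s by rewrite /g; ring.
  have [c hc ->] := mean_value _ _ hg s (s + y).
  rewrite (addrC s) addrK in hc *; rewrite normrM expr2 mulrA ler_wpM2r//.
  have := b2 (c - s); rewrite (addrC s) subrK => /le_trans; apply.
  by rewrite ler_wpM2l.
pose g z := f z - (z - s) * f1 s - (z - s) ^+ 2 / 2 * f2 s.
have hg (z : R) : is_derive z 1 g (f1 z - f1 s - (z - s) * f2 s).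
  by apply: is_derive_eq; rewrite /GRing.scale/=; field.
have -> : f (s + x) - f s - x * f1 s - x ^+ 2 / 2 * f2 s = g (s + x) - g s.
  by rewrite /g; field.
have [c hc ->] := mean_value _ _ hg s (s + x).
rewrite (addrC s) addrK in hc *; rewrite normrM exprSr mulrA ler_wpM2r//.
have := b1 (c - s); rewrite (addrC s) subrK => /le_trans; apply.
by rewrite ler_wpM2l// lerXn2r// nnegrE.
Qed.

Lemma gphiE x : gphi x = (@normal_peak R 1) * expR (- x ^+ 2 / 2).
Proof. by rewrite /gphi normal_pdfE ?oner_neq0// /normal_fun subr0 expr1n. Qed.

Lemma normal_peak1_bounds : 0 < @normal_peak R 1 <= 1.
Proof.
rewrite normal_peak_gt0 ?oner_neq0//= /normal_peak invf_le1.
  rewrite -[leLHS]sqrtr1 ler_wsqrtr// expr1n mul1r.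
  by have := @pi_ge2 R; rewrite mulr2n; lra.
by rewrite sqrtr_gt0 expr1n mul1r mulrn_wgt0// pi_gt0.
Qed.

Lemma gphi_gt0 x : 0 < gphi x.
Proof. by rewrite gphiE mulr_gt0 ?expR_gt0//; have /andP[] := normal_peak1_bounds. Qed.

(** Follows from exp y >= 1 + y and a peak at most 1. It gives at once that phi, |x| phi and x^2 phi
    / 2 are at most 1. *)
Lemma gphi_sqr_le x : (1 + x ^+ 2 / 2) * gphi x <= 1.
Proof.
rewrite gphiE; set P := normal_peak 1; have /andP[P0 P1] := normal_peak1_bounds.
rewrite mulNr expRN mulrCA -[leRHS](mulr1 1) ler_pM//.
- by rewrite ltW.
- by rewrite divr_ge0 ?expR_ge0// addr_ge0// divr_ge0// sqr_ge0.
- by rewrite ler_pdivrMr ?expR_gt0// mul1r expR_ge1Dx.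
Qed.

Lemma gphi_le1 x : gphi x <= 1.
Proof.
have := gphi_sqr_le x; have := gphi_gt0 x; have := sqr_ge0 x; nra.
Qed.

Lemma is_derive_gphi x : is_derive x 1 (@gphi R) (- x * gphi x).
Proof.
have -> : @gphi R = fun x => (@normal_peak R 1) * expR (- x ^+ 2 / 2).
  by apply/funext => y; rewrite gphiE.
by apply: is_derive_eq; rewrite /GRing.scale/=; field.
Qed.

Lemma gPhi_ge0 x : 0 <= gPhi x.
Proof. by rewrite fine_ge0. Qed.

Lemma gPhi_le1 x : gPhi x <= 1.
Proof.
rewrite /gPhi -lee_fin fineK ?fin_num_measure//.
exact: (@probability_le1 _ _ _ (normal_prob 0 1)).
Qed.

Lemma is_derive_gPhi x : is_derive x 1 (@gPhi R) (gphi x).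
Proof.
have [] := @continuous_FTC1 R (@normal_pdf R 0 1) -oo%O x (x + 1).
- by rewrite ltrDl.
- by apply: integrableS (integrable_normal_pdf 0 1).
- by rewrite ltNyr.
- by apply: continuous_normal_pdf; rewrite oner_neq0.
by move=> d e; apply: DeriveDef => //; rewrite -derive1E.
Qed.

Lemma gPhi_le x y : x <= y -> gPhi x <= gPhi y.
Proof.
move=> xy; apply: (derive_ge0_le _ _ is_derive_gPhi) => // z _.
exact/ltW/gphi_gt0.
Qed.

(** The identity, seen as a random variable under the Gaussian law, has [gPhi] as its [cdf]; this
    imports the limits of [gPhi] at both infinities. *)
Let NP : probability _ R := normal_prob (0 : R) 1.
Let idTR : measurableTypeR R -> R := idfun.
#[local] HB.instance Definition _ :=
  @isMeasurableFun.Build _ _ _ _ idTR (@measurable_id _ _ setT).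
Let X : {RV NP >-> R} := idTR.

Let cdfE : cdf X = EFin \o gPhi.
Proof. by apply/funext => x; rewrite /= /gPhi fineK ?fin_num_measure. Qed.

Lemma gPhi_cvgNy (e : R) : 0 < e -> exists2 a, a <= 0 & gPhi a < e.
Proof.
move=> e0; have := cvg_cdfNy0 X.
rewrite cdfE.
move=> /fine_cvgP[_] /= /cvgr0Pnorm_lt /(_ _ e0)[M [_ hM]].
exists (Num.min 0 (M - 1)); first by rewrite ge_min lexx.
have /= := hM (Num.min 0 (M - 1)); rewrite ger0_norm ?gPhi_ge0//; apply.
by rewrite gt_min gtrBl ltr01 orbT.
Qed.

Lemma gPhi_cvgy (e : R) : 0 < e -> exists2 a, 0 <= a & 1 - gPhi a < e.
Proof.
move=> e0; have := cvg_cdfy1 X.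
rewrite cdfE.
move=> /fine_cvgP[_] /= /cvgrPdist_lt /(_ _ e0)[M [_ hM]].
exists (Num.max 0 (M + 1)); first by rewrite le_max lexx.
have /= := hM (Num.max 0 (M + 1)); rewrite ger0_norm ?subr_ge0 ?gPhi_le1//; apply.
by rewrite lt_max ltrDl ltr01 orbT.
Qed.

Lemma gPhi_invK (e : R) : 0 < e < 1 -> gPhi (gPhi_inv e) = e.
Proof.
move=> /andP[e0 e1]; rewrite /gPhi_inv; case: xgetP => [y _ //|].
have [a a0 ha] := gPhi_cvgNy e e0.
have [b b0 hb] : exists2 b, 0 <= b & 1 - gPhi b < 1 - e by apply: gPhi_cvgy; rewrite subr_gt0.
have ab := le_trans a0 b0.
have [] := @IVT R gPhi a b e ab.
- by apply: continuous_subspaceT; apply: is_derive_continuous is_derive_gPhi.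
- by rewrite ge_min le_max (ltW ha)/=; apply/orP; right; lra.
by move=> c _ hc /(_ c); rewrite hc.
Qed.

(** The right side is E (s + G)^+, but no integral is computed. For fixed s the map z -> s Phi(z) +
    phi(z) has derivative (s - z) phi(z), hence is maximal at z = s, and its limits at -oo and +oo
    are 0 and s. *)
Lemma gPhi_mills s : Num.max 0 s <= s * gPhi s + gphi s.
Proof.
rewrite ge_max; apply/andP; split.
  have [s0|s0] := leP 0 s; first by rewrite addr_ge0 ?mulr_ge0 ?gPhi_ge0// ltW// gphi_gt0.
  rewrite leNgt; apply/negP => neg; set D := _ + _ in neg.
  have [a a0 ha] : exists2 a, a <= 0 & gPhi a < D / s.
    by apply: gPhi_cvgNy; rewrite nmulr_rgt0// invr_lt0.
  have le_as : Num.min a s <= s by rewrite ge_min lexx orbT.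
  have d (z : R) : is_derive z 1 (fun z => s * gPhi z + gphi z) ((s - z) * gphi z).
    have h1 := is_derive_gPhi z; have h2 := is_derive_gphi z.
    by apply: is_derive_eq; rewrite /GRing.scale/=; ring.
  have := derive_ge0_le _ _ d _ _ le_as; rewrite -/D leNgt => /(_ _)/negP; apply.
    by move=> z /andP[_ zs]; rewrite mulr_ge0 ?subr_ge0// ltW// gphi_gt0.
  rewrite -[ltLHS]addr0 ler_ltD ?gphi_gt0// mulrC -ler_ndivlMr// ltW//.
  by apply: le_lt_trans ha; apply: gPhi_le; rewrite ge_min lexx.
have [s0|s0] := leP s 0.
  by rewrite -[leLHS]addr0 lerD ?(ltW (gphi_gt0 _))// -[leLHS]mulr1 ler_wnM2l ?gPhi_le1.
rewrite leNgt; apply/negP => neg; set D := _ + _ in neg.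
have [a a0 ha] : exists2 a, 0 <= a & 1 - gPhi a < (s - D) / s.
  by apply: gPhi_cvgy; rewrite divr_gt0// subr_gt0.
have le_as : s <= Num.max a s by rewrite le_max lexx orbT.
have d (z : R) : is_derive z 1 (fun z => - s * gPhi z - gphi z) ((z - s) * gphi z).
  have h1 := is_derive_gPhi z; have h2 := is_derive_gphi z.
  by apply: is_derive_eq; rewrite /GRing.scale/=; ring.
have := derive_ge0_le _ _ d _ _ le_as.
have /[swap]/[apply] : forall x, s <= x <= Num.max a s -> 0 <= (x - s) * gphi x.
  by move=> z /andP[sz _]; rewrite mulr_ge0 ?subr_ge0// ltW// gphi_gt0.
have := gphi_gt0 (Num.max a s).
have : 1 - gPhi (Num.max a s) < (s - D) / s.
  by apply: le_lt_trans ha; rewrite lerD2l lerN2 gPhi_le// le_max lexx.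
rewrite ltr_pdivlMr// /D; lra.
Qed.

(* [gU r s] is the expectation of the positive part of [s + r G], [G] standard Gaussian. *)
Definition gU r s := s * gPhi (s / r) + r * gphi (s / r).

Lemma is_derive_gU_s r s : 0 < r -> is_derive s 1 (gU r) (gPhi (s / r)).
Proof.
move=> r0; rewrite /gU.
have h1 := is_derive_gPhi (s / r); have h2 := is_derive_gphi (s / r).
have h3 : is_derive s 1 (fun s => s / r) r^-1.
  by apply: is_derive_eq; rewrite /GRing.scale/=; ring.
have h4 : is_derive s 1 (fun s => gPhi (s / r)) _ := @is_derive1_comp R gPhi (fun s => s / r) s _ _ h1 h3.
have h5 : is_derive s 1 (fun s => gphi (s / r)) _ := @is_derive1_comp R gphi (fun s => s / r) s _ _ h2 h3.
apply: is_derive_eq; rewrite /GRing.scale/=; field.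
by rewrite gt_eqF.
Qed.

Lemma is_derive_gphi_scale r s : 0 < r ->
  is_derive s 1 (fun s => gphi (s / r) / r) (- (s / r) * gphi (s / r) / r ^+ 2).
Proof.
move=> r0.
have h2 := is_derive_gphi (s / r).
have h3 : is_derive s 1 (fun s => s / r) r^-1.
  by apply: is_derive_eq; rewrite /GRing.scale/=; ring.
have h5 : is_derive s 1 (fun s => gphi (s / r)) _ := @is_derive1_comp R gphi (fun s => s / r) s _ _ h2 h3.
apply: is_derive_eq; rewrite /GRing.scale/=; field.
by rewrite gt_eqF.
Qed.

Lemma is_derive_gPhi_scale r s : 0 < r ->
  is_derive s 1 (fun s => gPhi (s / r)) (gphi (s / r) / r).
Proof.
move=> r0; have h1 := is_derive_gPhi (s / r).
have h3 : is_derive s 1 (fun s => s / r) r^-1.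
  by apply: is_derive_eq; rewrite /GRing.scale/=; ring.
exact: (@is_derive1_comp R gPhi (fun s => s / r) s _ _ h1 h3).
Qed.

Lemma is_derive_gphi_inv r s : 0 < r ->
  is_derive r 1 (fun r => gphi (s / r)) ((s / r) ^+ 2 * gphi (s / r) / r).
Proof.
move=> r0; have h2 := is_derive_gphi (s / r).
have rn0 : r != 0 by rewrite gt_eqF.
have h3 : is_derive r 1 (fun r => s / r) (- s / r ^+ 2).
  have hV := @is_deriveV R (fun x => x) r 1 1 rn0 (is_derive_id r 1).
  have hM := is_deriveM (is_derive_cst s r 1) hV.
  by apply: (is_derive_eq hM); rewrite /GRing.scale/=; field.
have := @is_derive1_comp R gphi (fun r => s / r) r _ _ h2 h3.
by move=> h; apply: (is_derive_eq h); rewrite /GRing.scale/=; field.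
Qed.

(** Since the second derivative in s is phi(s / r) / r, this is the heat equation: the derivative in
    r equals r times the second derivative in s. *)
Lemma is_derive_gU_r r s : 0 < r -> is_derive r 1 (gU ^~ s) (gphi (s / r)).
Proof.
move=> r0; have h1 := is_derive_gPhi (s / r); rewrite /gU.
have rn0 : r != 0 by rewrite gt_eqF.
have h3 : is_derive r 1 (fun r => s / r) (- s / r ^+ 2).
  have hV := @is_deriveV R (fun x => x) r 1 1 rn0 (is_derive_id r 1).
  have hM := is_deriveM (is_derive_cst s r 1) hV.
  by apply: (is_derive_eq hM); rewrite /GRing.scale/=; field.
have h4 : is_derive r 1 (fun r => gPhi (s / r)) _ :=
  @is_derive1_comp R gPhi (fun r => s / r) r _ _ h1 h3.
have h5 := is_derive_gphi_inv _ s r0.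
by apply: is_derive_eq; rewrite /GRing.scale/=; field.
Qed.

(** The third derivative in s is -y phi(y) / r^2 with y = s / r, and |y| phi(y) <= 1. The factor
    r^-2 is the source of the harmonic sum. *)
Lemma gU_taylor r s x : 1 <= r ->
  `|gU r (s + x) - gU r s - x * gPhi (s / r) - x ^+ 2 / 2 * (gphi (s / r) / r)|
  <= r ^- 2 * `|x| ^+ 3.
Proof.
move=> r1; have r0 : 0 < r by apply: lt_le_trans r1.
apply: (@taylor2_bound (gU r) (fun s => gPhi (s / r)) (fun s => gphi (s / r) / r)
  (fun s => - (s / r) * gphi (s / r) / r ^+ 2)) => z.
- exact: is_derive_gU_s.
- exact: is_derive_gPhi_scale.
- exact: is_derive_gphi_scale.
have r20 : 0 < r ^+ 2 by rewrite exprn_gt0.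
rewrite normrM (@ger0_norm _ (r ^- 2)) ?invr_ge0 ?(ltW r20)//.
rewrite ler_piMl ?invr_ge0 ?(ltW r20)// normrM normrN (ger0_norm (ltW (gphi_gt0 _))).
have := gphi_sqr_le (z / r); have := gphi_gt0 (z / r).
set y := z / r; rewrite -(real_normK (num_real y)).
by move: `|y| => a; have := sqr_ge0 (a - 1); nra.
Qed.

(** First order expansion of [gU] in the variance, with a quadratic remainder. By the heat equation
    the linear coefficient is half the second derivative in s, the one that appears in
    [gU_taylor]. *)
Lemma gU_heat r1 r2 s : 1 <= r1 -> r1 <= r2 ->
  `|gU r2 s - gU r1 s - (r2 ^+ 2 - r1 ^+ 2) / 2 * (gphi (s / r1) / r1)|
  <= r1 ^- 2 * (r2 ^+ 2 - r1 ^+ 2) ^+ 2.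
Proof.
move=> r11 r12; have r10 : 0 < r1 by apply: lt_le_trans r11.
have [c /andP[r1c cr2] ->] := mean_value_itv (gU ^~ s) (fun r => gphi (s / r)) _ _ r12
  (fun x (h : r1 <= x <= r2) => is_derive_gU_r _ s (lt_le_trans r10 (proj1 (andP h)))).
have [d /andP[r1d dc]] := mean_value_itv (fun r => gphi (s / r)) _ _ _ r1c
  (fun x (h : r1 <= x <= c) => is_derive_gphi_inv _ s (lt_le_trans r10 (proj1 (andP h)))).
move BE : ((s / d) ^+ 2 * gphi (s / d) / d) => B hB.
have d0 : 0 < d by apply: lt_le_trans r1d.
have B0 : 0 <= B by rewrite -BE divr_ge0 ?(ltW d0)// mulr_ge0 ?sqr_ge0// ltW// gphi_gt0.
have B1 : B <= 2 / r1.
  rewrite -BE ler_pM ?invr_ge0 ?(ltW d0)//.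
  - by rewrite mulr_ge0 ?sqr_ge0// ltW// gphi_gt0.
  - by have := gphi_sqr_le (s / d); have := gphi_gt0 (s / d); set y := s / d; nra.
  - by rewrite lef_pV2.
have -> : gphi (s / c) = gphi (s / r1) + B * (c - r1) by rewrite -hB; ring.
set P := gphi (s / r1).
have P0 : 0 < P by exact: gphi_gt0.
have P1 : P <= 1 by exact: gphi_le1.
set e := r2 - r1; have e0 : 0 <= e by rewrite subr_ge0.
(* Two errors remain: the variation of phi(s / r) in r, and the gap between r2 - r1 and (r2^2 -
   r1^2) / (2 r1). With e = r2 - r1 they are at most 2 e^2 and e^2, while the right side is at least
   4 e^2. *)
have -> : (P + B * (c - r1)) * e - (r2 ^+ 2 - r1 ^+ 2) / 2 * (P / r1) =
   B * (c - r1) * e - P * e ^+ 2 / (2 * r1).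
  by rewrite /e; field; rewrite gt_eqF.
have -> : r1 ^- 2 * (r2 ^+ 2 - r1 ^+ 2) ^+ 2 = e ^+ 2 * ((r2 + r1) / r1) ^+ 2.
  by rewrite /e; field; rewrite gt_eqF.
have h4 : 4 <= ((r2 + r1) / r1) ^+ 2.
  have -> : 4 = 2 ^+ 2 :> R by ring.
  by rewrite lerXn2r ?nnegrE// ?ler_pdivlMr//; rewrite ?divr_ge0//; lra.
apply: (@le_trans _ _ (e ^+ 2 * 4)); last by rewrite ler_wpM2l ?sqr_ge0.
have u1 : 0 <= B * (c - r1) * e <= e ^+ 2 * 2.
  have ce : 0 <= c - r1 <= e by rewrite subr_ge0 r1c lerD2r.
  have B2 : B <= 2 by apply: (le_trans B1); rewrite ler_pdivrMr//; lra.
  have /andP[c0 c1] := ce.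
  apply/andP; split; first by apply: mulr_ge0 => //; apply: mulr_ge0.
  have -> : e ^+ 2 * 2 = 2 * e * e by ring.
  by rewrite ler_wpM2r// ler_pM.
have u2 : 0 <= P * e ^+ 2 / (2 * r1) <= e ^+ 2.
  have i0 : 0 < (2 * r1)^-1 by rewrite invr_gt0 mulr_gt0.
  have i1 : (2 * r1)^-1 <= 1 by rewrite invf_le1 ?mulr_gt0//; lra.
  apply/andP; split; first by rewrite !mulr_ge0 ?sqr_ge0 ?(ltW P0) ?(ltW i0).
  rewrite -[leRHS]mulr1 ler_pM ?mulr_ge0 ?sqr_ge0 ?(ltW i0) ?(ltW P0)//.
  by rewrite ler_piMl ?sqr_ge0.
by rewrite ler_norml; move: u1 u2 => /andP[? ?] /andP[? ?]; apply/andP; split; lra.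
Qed.

Lemma gU_ge r s : 0 < r -> Num.max 0 s <= gU r s.
Proof.
move=> r0; have := gPhi_mills (s / r); rewrite !ge_max => /andP[a b].
have -> : gU r s = r * (s / r * gPhi (s / r) + gphi (s / r)).
  by rewrite /gU; field; rewrite gt_eqF.
rewrite mulr_ge0 ?(ltW r0)//=.
by rewrite -ler_pdivrMl// mulrC.
Qed.

Lemma gU1_le s : gU 1 s <= Num.max 0 s + 1.
Proof.
rewrite /gU divr1 mul1r lerD ?gphi_le1// le_max.
have [s0|s0] := leP 0 s; first by rewrite ler_piMr ?gPhi_le1// orbT.
by rewrite nmulr_rle0// gPhi_ge0.
Qed.

Lemma gU_tangent_eq r w : 0 < r -> gU r (r * w) = gPhi w * (r * w) + r * gphi w.
Proof.
by move=> r0; rewrite /gU (mulrC r w) mulfK ?gt_eqF//; ring.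
Qed.

(** [gU r] is convex, its derivative Phi(s / r) being nondecreasing, so it lies above its tangent at
    r w. The slope of that tangent is Phi(w) and its intercept r phi(w). *)
Lemma gU_tangent r w s : 0 < r -> gPhi w * s + r * gphi w <= gU r s.
Proof.
move=> r0; set e := gPhi w.
have d (z : R) : is_derive z 1 (fun z => gU r z - e * z) (gPhi (z / r) - e).
  by have h := is_derive_gU_s _ z r0; apply: is_derive_eq; rewrite /GRing.scale/=; ring.
have d' (z : R) : is_derive z 1 (fun z => e * z - gU r z) (e - gPhi (z / r)).
  by have h := is_derive_gU_s _ z r0; apply: is_derive_eq; rewrite /GRing.scale/=; ring.
have [sw|/ltW ws] := leP s (r * w).
  have := derive_ge0_le _ _ d' _ _ sw.
  have /[swap]/[apply] : forall z, s <= z <= r * w -> 0 <= e - gPhi (z / r).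
    by move=> z /andP[_ zw]; rewrite subr_ge0 gPhi_le// ler_pdivrMr// mulrC.
  by rewrite gU_tangent_eq// -/e; lra.
have := derive_ge0_le _ _ d _ _ ws.
have /[swap]/[apply] : forall z, r * w <= z <= s -> 0 <= gPhi (z / r) - e.
  by move=> z /andP[zw _]; rewrite subr_ge0 gPhi_le// ler_pdivlMr// mulrC.
by rewrite gU_tangent_eq// -/e; lra.
Qed.

End gauss.

(** * Expectations over a countable alphabet *)

Section esum_toolkit.
Context {R : realType}.
Local Open Scope ereal_scope.

(** One inequality holds for every nonnegative factor; applying it to c and to 1 / c gives
    equality. *)
Lemma esumZl (I : choiceType) (a : I -> \bar R) (c : R) :
  (0 <= c)%R -> (forall i, 0 <= a i) ->
  \esum_(i in [set: I]) (c%:E * a i) = c%:E * \esum_(i in [set: I]) a i.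
Proof.
move=> c0 a0.
have le (k : R) b : (0 <= k)%R -> (forall i, 0 <= b i) ->
    \esum_(i in [set: I]) (k%:E * b i) <= k%:E * \esum_(i in [set: I]) b i.
  move=> k0 b0; apply: ge_ereal_sup => _ [X [finX XI]] <-.
  rewrite -ge0_mule_fsumr//; apply: lee_wpmul2l; first by rewrite lee_fin.
  by apply: ereal_sup_ubound; exists X.
move: c0; rewrite le_eqVlt => /predU1P[<-|c0].
  by rewrite mul0e esum1// => i _; rewrite mul0e.
apply/eqP; rewrite eq_le le ?(ltW c0)//=.
have -> : \esum_(i in [set: I]) a i = \esum_(i in [set: I]) (c^-1%:E * (c%:E * a i)).
  by apply: eq_esum => i _; rewrite muleA -EFinM mulVf ?mul1e// gt_eqF.
apply: (@le_trans _ _ (c%:E * (c^-1%:E * \esum_(i in [set: I]) (c%:E * a i)))).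
  apply: lee_wpmul2l; first by rewrite lee_fin ltW.
  by apply: le; [rewrite invr_ge0 ltW|move=> i; rewrite mule_ge0// lee_fin ltW].
by rewrite muleA -EFinM mulfV ?mul1e// gt_eqF.
Qed.

Lemma esum_tuple0 (A : choiceType) (f : 0.-tuple A -> \bar R) : (forall t, 0 <= f t) ->
  \esum_(t in [set: 0.-tuple A]) f t = f [tuple].
Proof.
move=> f0; rewrite (_ : [set: 0.-tuple A] = [set [tuple]]) ?esum_set1//.
by apply/seteqP; split => t // _; exact: tuple0.
Qed.

Lemma esum_tupleS (A : choiceType) n (f : n.+1.-tuple A -> \bar R) : (forall t, 0 <= f t) ->
  \esum_(t in [set: n.+1.-tuple A]) f t =
  \esum_(x in [set: A]) \esum_(t in [set: n.-tuple A]) f (cons_tuple x t).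
Proof.
move=> f0; rewrite esum_esum//.
rewrite (@reindex_esum _ _ _ [set: A * n.-tuple A] _
  (fun k => cons_tuple k.1 k.2))//.
  by congr esum; apply/seteqP; split => -[].
split => //.
- by move=> [x t] [x' t'] _ _ /= /(congr1 val)/= [-> /val_inj ->].
- move=> t _; exists (thead t, [tuple of behead t]) => //=.
  by rewrite [RHS]tuple_eta; apply: val_inj.
Qed.

End esum_toolkit.

Section expectation.
Context {R : realType} {I : choiceType}.
Implicit Types q f g : I -> R.
Local Open Scope ereal_scope.

(** A supremum of finite sums, hence the expectation of f only when q f >= 0. This is why additivity
    below asks for nonnegative functions. *)
Definition Ex q f : \bar R := \esum_(x in [set: I]) (q x * f x)%:E.

Lemma Ex_le q f g : (forall x, 0 <= q x)%R -> (forall x, 0 < q x -> f x <= g x)%R ->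
  Ex q f <= Ex q g.
Proof.
move=> q0 fg; apply: le_esum => x _; rewrite lee_fin.
have := q0 x; rewrite le_eqVlt => /predU1P[<-|qx]; first by rewrite !mul0r.
by rewrite ler_wpM2l ?fg// ltW.
Qed.

Lemma eq_Ex q f g : (forall x, q x != 0 -> f x = g x)%R -> Ex q f = Ex q g.
Proof.
move=> fg; apply: eq_esum => x _.
by have [->|/fg ->//] := eqVneq (q x) 0%R; rewrite !mul0r.
Qed.

Lemma Ex_ge0 q f : (forall x, 0 <= q x)%R -> (forall x, 0 <= f x)%R -> 0 <= Ex q f.
Proof. by move=> q0 f0; apply: esum_ge0 => x _; rewrite lee_fin mulr_ge0. Qed.

Lemma ExD q f g : (forall x, 0 <= q x)%R -> (forall x, 0 <= f x)%R ->
  (forall x, 0 <= g x)%R -> Ex q (fun x => f x + g x)%R = Ex q f + Ex q g.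
Proof.
move=> q0 f0 g0; rewrite /Ex -esumD.
- by apply: eq_esum => x _; rewrite -EFinD mulrDr.
- by move=> x _; rewrite lee_fin mulr_ge0.
- by move=> x _; rewrite lee_fin mulr_ge0.
Qed.

Lemma ExZ q f (c : R) : (forall x, 0 <= q x)%R -> (forall x, 0 <= f x)%R ->
  (0 <= c)%R -> Ex q (fun x => c * f x)%R = c%:E * Ex q f.
Proof.
move=> q0 f0 c0; rewrite /Ex -esumZl//.
  by apply: eq_esum => x _; rewrite -EFinM mulrCA.
by move=> x; rewrite lee_fin mulr_ge0.
Qed.

Lemma Ex_cst q (c : R) : (forall x, 0 <= q x)%R ->
  \esum_(x in [set: I]) (q x)%:E = 1 -> (0 <= c)%R -> Ex q (cst c) = c%:E.
Proof.
move=> q0 q1 c0; rewrite /Ex.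
under eq_esum do rewrite /= mulrC EFinM.
by rewrite esumZl ?q1 ?mule1// => x; rewrite lee_fin.
Qed.

End expectation.

(** * One exchange: a single term against a Gaussian of the same variance *)

Section one_step.
Context {R : realType} {I : choiceType} (q Z : I -> R) (H V T : R).
Hypothesis q0 : forall x, 0 <= q x.
Hypothesis q1 : (\esum_(x in [set: I]) (q x)%:E = 1)%E.
Hypothesis Z0 : forall x, 0 <= Z x.
Hypothesis H0 : 0 <= H.
Hypothesis hH : Ex q Z = H%:E.
Hypothesis hV : Ex q (fun x => (Z x - H) ^+ 2) = V%:E.
Hypothesis hT : (Ex q (fun x => `|Z x - H| ^+ 3)%R <= T%:E)%E.
Local Open Scope ereal_scope.

Let V0 : (0 <= V)%R.
Proof. by rewrite -lee_fin -hV Ex_ge0// => x; rewrite sqr_ge0. Qed.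

Let T0 : (0 <= T)%R.
Proof. by rewrite -lee_fin (le_trans _ hT)// Ex_ge0// => x; rewrite exprn_ge0. Qed.

Variables (r r2 s : R).
Hypotheses (r1 : (1 <= r)%R) (r20 : (0 <= r2)%R) (hr2 : (r2 ^+ 2 = r ^+ 2 + V)%R).

Let r0 : (0 < r)%R. Proof. exact: lt_le_trans r1. Qed.

Let rr2 : (r <= r2)%R.
Proof. by rewrite -(@ler_pXn2r _ 2) ?nnegrE ?(ltW r0)// hr2 lerDl. Qed.

Let r2p : (0 < r2)%R. Proof. exact: lt_le_trans rr2. Qed.

Let gU_ge0 r' s' : (0 < r')%R -> (0 <= gU r' s' :> R)%R.
Proof. by move=> r'0; have := gU_ge r' s' r'0; rewrite ge_max => /andP[]. Qed.

(** Expanding in Z - H and averaging leaves U(r, s) plus V / 2 times the second derivative, up to T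
    / r^2; expanding U(r2, s) in the variance leaves the same quantity, up to V^2 / r^2. *)
Lemma gU_step_le :
  Ex q (fun x => gU r (s + (Z x - H)))%R <= (gU r2 s + (T + V ^+ 2) / r ^+ 2)%:E.
Proof.
set P := gPhi (s / r); have P0 : (0 <= P)%R := gPhi_ge0 _.
set g := (gphi (s / r) / r)%R.
have g0 : (0 <= g)%R by rewrite divr_ge0 ?(ltW r0)// ltW// gphi_gt0.
have i0 : (0 <= r ^- 2)%R by rewrite invr_ge0 exprn_ge0// ltW.
have := gU_heat r r2 s r1 rr2; rewrite hr2 (addrC (r ^+ 2)%R) addrK -/g ler_norml => /andP[h1 _].
have [f fE] : exists f : I -> R, f = (fun x => gU r (s + (Z x - H)))%R by eexists.
have f0 x : (0 <= f x)%R by rewrite fE gU_ge0.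
have c0 := gU_ge0 _ s r0.
have tay x : (`|f x - gU r s - (Z x - H) * P - (Z x - H) ^+ 2 / 2 * g| <= r ^- 2 * `|Z x - H| ^+ 3)%R.
  by rewrite fE; exact: gU_taylor.
rewrite -fE; move: (gU r s) c0 tay h1 => c c0 tay h1 {fE}.
(* The linear term (Z - H) P changes sign. Adding the constant H P on the left makes all summands
   nonnegative, so that both expectations split. *)
have : Ex q (fun x => f x + cst (H * P) x)%R <=
   Ex q (fun x => cst c x + (P * Z x + (g / 2 * (Z x - H) ^+ 2 + r ^- 2 * `|Z x - H| ^+ 3)))%R.
  apply: Ex_le => // x _ /=; have := tay x.
  by rewrite ler_norml => /andP[_]; lra.
rewrite ExD//; [|by move=> x; rewrite mulr_ge0].
rewrite ExD//; last first.
- by move=> x; rewrite !addr_ge0// mulr_ge0 ?sqr_ge0// divr_ge0.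
rewrite ExD//; last 2 first.
- by move=> x; rewrite mulr_ge0.
- by move=> x; rewrite !addr_ge0// mulr_ge0 ?sqr_ge0// divr_ge0.
rewrite ExD//; last 2 first.
- by move=> x; rewrite mulr_ge0 ?sqr_ge0// divr_ge0.
- by move=> x; rewrite mulr_ge0.
rewrite !ExZ//; [|by move=> x; rewrite sqr_ge0|by rewrite divr_ge0].
rewrite !Ex_cst ?mulr_ge0// hH hV => /le_trans h.
have {}h : Ex q f + (H * P)%:E <= (c + (P * H + (g / 2 * V + r ^- 2 * T)))%:E.
  apply: h; rewrite -!EFinM !EFinD !leeD2l//.
  by rewrite EFinM lee_wpmul2l// lee_fin.
move: h; rewrite -leeBrDr// -EFinB => /le_trans; apply; rewrite lee_fin.
by rewrite mulrDl (mulrC T); lra.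
Qed.

Lemma gU_step_ge :
  (gU r2 s)%:E <= Ex q (fun x => gU r (s + (Z x - H)))%R + ((T + V ^+ 2) / r ^+ 2)%:E.
Proof.
set P := gPhi (s / r); have P0 : (0 <= P)%R := gPhi_ge0 _.
set g := (gphi (s / r) / r)%R.
have g0 : (0 <= g)%R by rewrite divr_ge0 ?(ltW r0)// ltW// gphi_gt0.
have i0 : (0 <= r ^- 2)%R by rewrite invr_ge0 exprn_ge0// ltW.
have := gU_heat r r2 s r1 rr2; rewrite hr2 (addrC (r ^+ 2)%R) addrK -/g ler_norml => /andP[_ h1].
have [f fE] : exists f : I -> R, f = (fun x => gU r (s + (Z x - H)))%R by eexists.
have f0 x : (0 <= f x)%R by rewrite fE gU_ge0.
have c0 := gU_ge0 _ s r0.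
have tay x : (`|f x - gU r s - (Z x - H) * P - (Z x - H) ^+ 2 / 2 * g| <= r ^- 2 * `|Z x - H| ^+ 3)%R.
  by rewrite fE; exact: gU_taylor.
rewrite -fE; move: (gU r s) c0 tay h1 => c c0 tay h1 {fE}.
have : Ex q (fun x => cst c x + (P * Z x + (g / 2 * (Z x - H) ^+ 2)))%R <=
   Ex q (fun x => f x + (cst (H * P) x + r ^- 2 * `|Z x - H| ^+ 3))%R.
  apply: Ex_le => // x _ /=; have := tay x.
  by rewrite ler_norml => /andP[+ _]; lra.
rewrite (ExD _ f)//; last first.
- by move=> x; rewrite addr_ge0 ?mulr_ge0.
rewrite (ExD _ (cst c))//; last first.
- by move=> x; rewrite !addr_ge0// mulr_ge0 ?sqr_ge0// divr_ge0.
rewrite (ExD _ (fun x => P * Z x)%R)//; last 2 first.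
- by move=> x; rewrite mulr_ge0.
- by move=> x; rewrite mulr_ge0 ?sqr_ge0// divr_ge0.
rewrite (ExD _ (cst (H * P)%R))//; last 2 first.
- by move=> x; rewrite mulr_ge0.
- by move=> x; rewrite mulr_ge0.
rewrite !ExZ//; [|by move=> x; rewrite sqr_ge0|by rewrite divr_ge0].
rewrite !Ex_cst ?mulr_ge0// hH hV -!EFinM -!EFinD.
move: (Ex q f) => E h.
have {}h : (c + (P * H + g / 2 * V))%:E <= E + (H * P + r ^- 2 * T)%:E.
  apply: (le_trans h); rewrite EFinD leeD2l// leeD2l//.
  by rewrite EFinM lee_wpmul2l// lee_fin.
move: h; rewrite -leeBlDr// -EFinB => h.
rewrite -leeBlDr// -EFinB (le_trans _ h)// lee_fin.
by rewrite mulrDl (mulrC T); lra.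
Qed.

End one_step.

(** * Normal approximation by one-step exchanges *)

Set Implicit Arguments.
Unset Strict Implicit.
Unset Printing Implicit Defensive.

Lemma cons_tuple_eta T n (t : n.+1.-tuple T) : t = cons_tuple (thead t) [tuple of behead t].
Proof. by rewrite [LHS]tuple_eta; apply: val_inj. Qed.

Section source.
Context {R : realType} {d : measure_display} {TY : measurableType d}.
Variable p : nat -> TY -> R.
Hypothesis hp : cond_pmf p.

Let p0 x y : 0 <= p x y. Proof. by case: hp. Qed.
Let p1 y : (\esum_(x in [set: nat]) (p x y)%:E = 1)%E. Proof. by case: hp. Qed.

Lemma ln2_gt0 : 0 < ln 2 :> R.
Proof. by rewrite ln_gt0// ltr1n. Qed.

Lemma cond_pmf_le1 x y : p x y <= 1.
Proof.
rewrite -lee_fin -(p1 y) (esumID [set x]).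
  by rewrite setTI esum_set1 ?lee_fin// leeDl// esum_ge0// => i _; rewrite lee_fin.
by move=> i _; rewrite lee_fin.
Qed.

Lemma iota_ge0 x y : 0 <= iota p x y.
Proof.
(* The case of probability zero relies on the conventions 1 / 0 = 0 and ln 0 = 0. *)
rewrite /iota /log2 divr_ge0 ?(ltW ln2_gt0)//.
have := p0 x y; rewrite le_eqVlt => /predU1P[<-|px].
  by rewrite invr0 mulr0 ln0.
by rewrite ln_ge0// div1r invf_ge1// cond_pmf_le1.
Qed.

Definition entr y : R := fine (condH p y).
Definition vari y : R := fine (condV p y).

Lemma condHE y : condH p y = Ex (p ^~ y) (iota p ^~ y).
Proof. by []. Qed.

Lemma condH_ge0 y : (0 <= condH p y)%E.
Proof. by rewrite condHE Ex_ge0// => x; exact: iota_ge0. Qed.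

Lemma entr_ge0 y : 0 <= entr y.
Proof. by rewrite fine_ge0// condH_ge0. Qed.

Lemma cond_pmf_pos y : exists x, 0 < p x y.
Proof.
apply: contrapT => h; have /eqP := p1 y; rewrite esum1 ?eqe 1?eq_sym ?oner_eq0//.
move=> x _; congr EFin; apply/eqP; rewrite eq_le p0 andbT leNgt.
by apply/negP => ?; apply: h; exists x.
Qed.

(** If the entropy were infinite, the deviation of any symbol of positive probability would be
    infinite, and so would the third moment. *)
Lemma condH_fin y C : (condT p y <= C%:E)%E -> condH p y = (entr y)%:E.
Proof.
move=> hC; rewrite /entr; have := condH_ge0 y.
case E : (condH p y) => [h||]//= _; exfalso.
have [x px] := cond_pmf_pos y.
have := hC; rewrite /condT (esumID [set x]); last first.
  by move=> i _; rewrite mule_ge0// ?lee_fin// !mule_ge0.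
have -> : condH p y = +oo%E := E.
have tE : ((p x y)%:E * (`|(iota p x y)%:E - +oo| * `|(iota p x y)%:E - +oo| *
    `|(iota p x y)%:E - +oo|) = +oo)%E.
  by rewrite /= !mulyy gt0_muley// lte_fin.
rewrite setTI esum_set1 tE ?leey//.
rewrite (_ : (+oo + _ = +oo)%E) ?leye_eq//.
rewrite addye// gt_eqF// (lt_le_trans (ltNyr 0))// esum_ge0// => i _.
by rewrite mule_ge0// ?lee_fin// !mule_ge0.
Qed.

Lemma condVE y h : condH p y = h%:E -> condV p y = Ex (p ^~ y) (fun x => (iota p x y - h) ^+ 2).
Proof.
move=> e; rewrite /condV /Ex; apply: eq_esum => x _.
by rewrite e -EFinB -!EFinM expr2.
Qed.

Lemma condTE y h : condH p y = h%:E -> condT p y = Ex (p ^~ y) (fun x => `|iota p x y - h| ^+ 3).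
Proof.
move=> e; rewrite /condT /Ex; apply: eq_esum => x _.
by rewrite e -EFinB /= -!EFinM; congr EFin; ring.
Qed.

Variables (c C : R).
Hypotheses (c0 : 0 < c) (C0 : 0 <= C).

Definition regular y := (c%:E <= condV p y)%E /\ (condT p y <= C%:E)%E.

Lemma regularH y : regular y -> condH p y = (entr y)%:E.
Proof. by move=> [_ /condH_fin]. Qed.

(** Uses a^2 <= 1 + a^3 for a >= 0. *)
Lemma regularV_le y : regular y -> (condV p y <= (1 + C)%:E)%E.
Proof.
move=> gy; have eH := regularH gy; have [_ hT] := gy.
rewrite (condVE eH) EFinD; move: hT; rewrite (condTE eH) => hT.
apply: (@le_trans _ _ (Ex (p ^~ y) (fun x => cst 1 x + `|iota p x y - entr y| ^+ 3))).
  apply: Ex_le => // x _ /=; rewrite -(real_normK (num_real (iota p x y - entr y))).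
  move: (`|_|) (normr_ge0 (iota p x y - entr y)) => a a0.
  have [a1|a1] := leP a 1; first by have := exprn_ge0 3 a0; nra.
  by rewrite !exprS expr0; nra.
rewrite ExD//.
by rewrite (Ex_cst (p ^~ y) 1 (p0 ^~ y) (p1 y) ler01) leeD2l.
Qed.

Lemma regularV y : regular y -> condV p y = (vari y)%:E.
Proof.
move=> gy; rewrite /vari fineK// ge0_fin_numE.
  by rewrite (le_lt_trans (regularV_le gy))// ltry.
by rewrite (le_trans _ gy.1)// lee_fin ltW.
Qed.

Lemma vari_bounds y : regular y -> c <= vari y <= 1 + C.
Proof. by move=> gy; rewrite -!lee_fin -regularV// gy.1 regularV_le. Qed.

Lemma pn_ge0 n (xs : n.-tuple nat) ys : 0 <= pn p xs ys.
Proof. by apply: prodr_ge0. Qed.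

Lemma pn_cons n x y (xs : n.-tuple nat) ys :
  pn p (cons_tuple x xs) (cons_tuple y ys) = p x y * pn p xs ys.
Proof.
rewrite /pn big_ord_recl !tnth0; congr (_ * _).
by apply: eq_bigr => i _; rewrite !tnthS.
Qed.

Lemma Ex_pn0 (ys : 0.-tuple TY) (f : 0.-tuple nat -> R) : (forall t, 0 <= f t) ->
  Ex (fun xs => pn p xs ys) f = (f [tuple])%:E.
Proof.
move=> f0; rewrite /Ex esum_tuple0; last by move=> t; rewrite lee_fin mulr_ge0// pn_ge0.
by rewrite /pn big_ord0 mul1r.
Qed.

Lemma Ex_pnS n y (ys : n.-tuple TY) (f : n.+1.-tuple nat -> R) : (forall t, 0 <= f t) ->
  Ex (fun xs => pn p xs (cons_tuple y ys)) f =
  (\esum_(x in [set: nat]) ((p x y)%:E * Ex (fun xs => pn p xs ys) (fun xs => f (cons_tuple x xs))))%E.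
Proof.
move=> f0; rewrite /Ex esum_tupleS; last by move=> t; rewrite lee_fin mulr_ge0// pn_ge0.
apply: eq_esum => x _; rewrite -esumZl//; last first.
  by move=> t; rewrite lee_fin mulr_ge0// pn_ge0.
by apply: eq_esum => t _; rewrite pn_cons -EFinM mulrA.
Qed.

Lemma pn_sum1 n (ys : n.-tuple TY) : (\esum_(xs in [set: n.-tuple nat]) (pn p xs ys)%:E = 1)%E.
Proof.
suff : (Ex (fun xs => pn p xs ys) (cst 1%R) = 1)%E.
  by rewrite /Ex; under eq_esum do rewrite mulr1.
elim: n ys => [|n ih] ys; first by rewrite Ex_pn0.
rewrite (cons_tuple_eta ys) Ex_pnS// -[RHS](p1 (thead ys)).
by apply: eq_esum => x _; rewrite [X in (_ * X)%E](ih _) mule1.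
Qed.

Definition info_dev n (xs : n.-tuple nat) (ys : n.-tuple TY) : R :=
  \sum_(i < n) (iota p (tnth xs i) (tnth ys i) - entr (tnth ys i)).

Definition excess n (ys : n.-tuple TY) (s : R) : \bar R :=
  Ex (fun xs => pn p xs ys) (fun xs => Num.max 0 (s + info_dev xs ys)).

(** The added 1 is the variance of an auxiliary Gaussian. It keeps the standard deviation at least 1
    during all exchanges, and once no letter is left it costs the difference between [gU 1 s] and
    max(0, s), at most 1. *)
Definition sdev n (ys : n.-tuple TY) : R := Num.sqrt (1 + \sum_(i < n) vari (tnth ys i)).

(** The leading 1 pays for the auxiliary Gaussian. The k-th summand bounds (T + V^2) / r^2 for an
    exchange with k letters behind it: T <= C, V <= 1 + C and r^2 >= 1 + c k. *)
Definition lindeberg_err (n : nat) : R :=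
  1 + \sum_(k < n) (C + (1 + C) ^+ 2) / (1 + c * k%:R).

Let K0 : 0 <= C + (1 + C) ^+ 2. Proof. by rewrite addr_ge0 ?sqr_ge0. Qed.

Lemma info_dev_cons n x y (xs : n.-tuple nat) ys :
  info_dev (cons_tuple x xs) (cons_tuple y ys) = iota p x y - entr y + info_dev xs ys.
Proof.
rewrite /info_dev big_ord_recl !tnth0; congr (_ + _).
by apply: eq_bigr => i _; rewrite !tnthS.
Qed.

Lemma sum_vari_ge n (ys : n.-tuple TY) : (forall i, regular (tnth ys i)) ->
  c * n%:R <= \sum_(i < n) vari (tnth ys i).
Proof.
move=> g; rewrite mulr_natr -[in leLHS](card_ord n) -sumr_const.
by apply: ler_sum => i _; have /andP[] := vari_bounds (g i).
Qed.

Lemma sdev_sq n (ys : n.-tuple TY) : (forall i, regular (tnth ys i)) ->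
  sdev ys ^+ 2 = 1 + \sum_(i < n) vari (tnth ys i).
Proof.
move=> g; rewrite sqr_sqrtr// addr_ge0// (le_trans _ (sum_vari_ge g))//.
by rewrite mulr_ge0 ?(ltW c0).
Qed.

Lemma sdev_ge1 n (ys : n.-tuple TY) : (forall i, regular (tnth ys i)) -> 1 <= sdev ys.
Proof.
move=> g; rewrite -[leLHS]sqrtr1 ler_wsqrtr// lerDl (le_trans _ (sum_vari_ge g))//.
by rewrite mulr_ge0 ?(ltW c0).
Qed.

Lemma lindeberg_err_ge0 n : 0 <= lindeberg_err n.
Proof.
rewrite addr_ge0// sumr_ge0// => k _; rewrite divr_ge0// addr_ge0// mulr_ge0//.
exact: ltW.
Qed.

Lemma excess_cons n y (ys : n.-tuple TY) s : excess (cons_tuple y ys) s =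
  (\esum_(x in [set: nat]) ((p x y)%:E * excess ys (s + (iota p x y - entr y))))%E.
Proof.
rewrite /excess Ex_pnS; last by move=> t; rewrite le_max lexx.
apply: eq_esum => x _; congr (_ * _)%E; apply: eq_Ex => xs _.
by rewrite info_dev_cons addrA.
Qed.

Lemma step_err n y (ys : n.-tuple TY) :
  (forall i, regular (tnth (cons_tuple y ys) i)) ->
  (C + vari y ^+ 2) / sdev ys ^+ 2 <= (C + (1 + C) ^+ 2) / (1 + c * n%:R).
Proof.
move=> g; have gy : regular y by have := g ord0; rewrite tnth0.
have gys i : regular (tnth ys i) by have := g (lift ord0 i); rewrite tnthS.
have /andP[v1 v2] := vari_bounds gy.
have v0 : 0 <= vari y by rewrite (le_trans _ v1)// ltW.
have d0 : 0 < 1 + c * n%:R by rewrite ltr_wpDr// mulr_ge0// ltW.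
rewrite ler_pM//.
- by rewrite addr_ge0 ?sqr_ge0.
- by rewrite invr_ge0 sqr_ge0.
- by rewrite lerD2l lerXn2r// nnegrE// (le_trans v0).
- rewrite lef_pV2 ?posrE//; last by rewrite exprn_gt0// (lt_le_trans _ (sdev_ge1 gys)).
  by rewrite sdev_sq// lerD2l sum_vari_ge.
Qed.

(** Induction on the block with s arbitrary: given the first letter, its deviation is absorbed into
    s and the other letters are already Gaussian; [gU_step_le] and [gU_step_ge] then exchange the
    first letter. *)
Lemma normal_approx n (ys : n.-tuple TY) s : (forall i, regular (tnth ys i)) ->
  (excess ys s <= (gU (sdev ys) s + lindeberg_err n)%:E)%E /\
  ((gU (sdev ys) s)%:E <= excess ys s + (lindeberg_err n)%:E)%E.
Proof.
elim: n ys s => [|n ih] ys s.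
  move=> _; rewrite /excess Ex_pn0; last by move=> t; rewrite le_max lexx.
  rewrite /info_dev /sdev !big_ord0 !addr0 sqrtr1 /lindeberg_err big_ord0 addr0.
  have := gU_ge 1 s ltr01; have := gU1_le s => h1 h2.
  by split; rewrite lee_fin//; lra.
rewrite (cons_tuple_eta ys); move: (thead ys) [tuple of behead ys] => y {}ys g.
have gy : regular y by have := g ord0; rewrite tnth0.
have gys i : regular (tnth ys i) by have := g (lift ord0 i); rewrite tnthS.
have hr1 := sdev_ge1 gys.
have hr2 : sdev (cons_tuple y ys) ^+ 2 = sdev ys ^+ 2 + vari y.
  rewrite !sdev_sq// big_ord_recl tnth0 -addrA (addrC (vari y)); congr (_ + (_ + _)).
  by apply: eq_bigr => i _; rewrite tnthS.
have r20 : 0 <= sdev (cons_tuple y ys) by rewrite sqrtr_ge0.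
have eH := regularH gy.
have hH : Ex (p ^~ y) (iota p ^~ y) = (entr y)%:E by rewrite -condHE.
have hV := condVE eH; rewrite (regularV gy) in hV.
have hT := gy.2; rewrite (condTE eH) in hT.
have up := gU_step_le (p ^~ y) (iota p ^~ y) (entr y) (vari y) C (p0 ^~ y) (p1 y)
  (iota_ge0 ^~ y) (entr_ge0 y) hH (esym hV) hT _ _ s hr1 r20 hr2.
have lo := gU_step_ge (p ^~ y) (iota p ^~ y) (entr y) (vari y) C (p0 ^~ y) (p1 y)
  (iota_ge0 ^~ y) (entr_ge0 y) hH (esym hV) hT _ _ s hr1 r20 hr2.
have err := step_err g.
set E := (_ / _) in up lo err.
have Bn0 := lindeberg_err_ge0 n.
have BS : lindeberg_err n.+1 = lindeberg_err n + (C + (1 + C) ^+ 2) / (1 + c * n%:R).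
  by rewrite /lindeberg_err big_ord_recr/= addrA.
have U0 x : 0 <= gU (sdev ys) (s + (iota p x y - entr y)).
  have := gU_ge (sdev ys) (s + (iota p x y - entr y)) (lt_le_trans ltr01 hr1).
  by rewrite ge_max => /andP[].
have [f fE] : exists f : nat -> R, f = (fun x => gU (sdev ys) (s + (iota p x y - entr y))).
  by eexists.
have f0 x : 0 <= f x by rewrite fE.
rewrite -fE in up lo.
have excess0 s' : (0 <= excess ys s')%E.
  by apply: Ex_ge0 => t; [exact: pn_ge0|rewrite le_max lexx].
rewrite excess_cons; split.
  apply: (@le_trans _ _ (Ex (p ^~ y) (fun x => f x + cst (lindeberg_err n) x))).
    apply: le_esum => x _; rewrite EFinM lee_wpmul2l ?lee_fin// fE.
    by have [h _] := ih ys (s + (iota p x y - entr y)) gys.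
  rewrite (ExD _ f)// Ex_cst//.
  apply: (le_trans (leeD2r _ up)); rewrite -EFinD lee_fin BS; lra.
apply: (le_trans lo); rewrite BS EFinD addeA.
apply: leeD; last by rewrite lee_fin.
rewrite -(Ex_cst (p ^~ y) (lindeberg_err n) (p0 ^~ y) (p1 y) Bn0) -esumD.
- apply: le_esum => x _; rewrite [X in (_ + X)%E]EFinM -ge0_muleDr ?lee_fin//.
  rewrite EFinM lee_wpmul2l ?lee_fin// fE.
  by have [_ h] := ih ys (s + (iota p x y - entr y)) gys.
- by move=> x _; rewrite mule_ge0 ?lee_fin.
- by move=> x _; rewrite lee_fin mulr_ge0.
Qed.

End source.

(** * Iterated integrals *)

Section measurability.
Context {R : realType} {d : measure_display} {T : measurableType d}.
Local Open Scope ereal_scope.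

(** Lists the sum along the codes of the countable type, with 0 at codes of no element, so that
    measurability of series of functions applies to [esum]. *)
Lemma esum_nneseries (I : countType) (a : I -> \bar R) : (forall i, 0 <= a i) ->
  \esum_(i in [set: I]) a i = \sum_(k <oo) oapp a 0 (pickle_inv k).
Proof.
move=> a0; rewrite nneseries_esumT; last by move=> k; case: pickle_inv => //=.
pose b k := oapp a 0 (@pickle_inv I k).
have -> : \esum_(i in [set: I]) a i = \esum_(i in [set: I]) b (pickle i).
  by apply: eq_esum => i _; rewrite /b pickleK_inv.
rewrite -(esum_image [set: I] pickle b); last by move=> x y _ _; exact: (pcan_inj pickleK).
rewrite esum_mkcond; apply: eq_esum => k _; case: ifPn => //.
rewrite notin_setE /= /b => h; case E : (pickle_inv k) => [i|]//; exfalso; apply: h.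
by exists i => //; have := @pickle_invK I k; rewrite E.
Qed.

Lemma measurable_esum (I : countType) (f : I -> T -> \bar R) :
  (forall i t, 0 <= f i t) -> (forall i, measurable_fun [set: T] (f i)) ->
  measurable_fun [set: T] (fun t => \esum_(i in [set: I]) f i t).
Proof.
move=> f0 mf; under eq_fun do rewrite esum_nneseries//.
pose h k t := oapp (f ^~ t) 0 (@pickle_inv I k).
have := @ge0_emeasurable_sum _ T R setT h xpredT; apply.
- by move=> k t _ _; rewrite /h; case: pickle_inv => /=.
- by move=> k _; rewrite /h; case: pickle_inv => //=.
Qed.

End measurability.

Section iterated_integral.
Context {R : realType} {d : measure_display} {TY : measurableType d}.
Variable PY : probability TY R.
Local Open Scope ereal_scope.

Lemma measurable_cons_pair n d' (S : measurableType d') :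
  measurable_fun [set: _] (fun k : (S * TY) * n.-tuple TY => (k.1.1, cons_tuple k.1.2 k.2)).
Proof.
apply: measurable_fun_pair; first exact: measurableT_comp.
by apply: measurable_cons; first exact: measurableT_comp.
Qed.

Lemma measurable_cons1 n y : measurable_fun [set: _] (fun t : n.-tuple TY => cons_tuple y t).
Proof. by apply: measurable_cons. Qed.

Lemma iint_ge0 n (f : n.-tuple TY -> \bar R) : (forall t, 0 <= f t) -> 0 <= iint PY f.
Proof.
elim: n f => [|n ih] f f0 /=; first exact: f0.
by apply: integral_ge0 => y _; apply: ih.
Qed.

(** The parameter space varies in the induction: each step moves one letter from the tuple into the
    parameter, and the measurability half of Tonelli's theorem integrates it out. *)
Lemma measurable_iint n d' (S : measurableType d') (f : S * n.-tuple TY -> \bar R) :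
  (forall k, 0 <= f k) -> measurable_fun [set: _] f ->
  measurable_fun [set: _] (fun s => iint PY (fun t => f (s, t))).
Proof.
elim: n d' S f => [|n ih] d' S f f0 mf /=.
  by apply: (measurableT_comp mf); apply: measurable_fun_pair.
pose g (k : (S * TY) * n.-tuple TY) := f (k.1.1, cons_tuple k.1.2 k.2).
have mg : measurable_fun [set: _] g by apply: (measurableT_comp mf); exact: measurable_cons_pair.
have mh := ih _ (S * TY)%type g (fun k => f0 _) mg.
have h0 k : 0 <= iint PY (fun t => g (k, t)) by apply: iint_ge0 => t; exact: f0.
exact: (@measurable_fun_fubini_tonelli_F _ _ S TY R PY _ mh h0).
Qed.

Lemma measurable_iint_cons n (f : n.+1.-tuple TY -> \bar R) :
  (forall t, 0 <= f t) -> measurable_fun [set: _] f ->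
  measurable_fun [set: _] (fun y => iint PY (fun t => f (cons_tuple y t))).
Proof.
move=> f0 mf; pose g (k : TY * n.-tuple TY) := f (cons_tuple k.1 k.2).
apply: (@measurable_iint _ _ _ g) => [k|]; first exact: f0.
apply: (measurableT_comp mf); exact: measurable_cons.
Qed.

(** The comparison is needed only on tuples with all letters in [G]. Exceptional letters are
    discarded one integral at a time, so no product measure is formed. *)
Lemma iint_le n (G : set TY) (f g : n.-tuple TY -> \bar R) :
  (\forall y \ae PY, G y) ->
  (forall t, 0 <= f t) -> (forall t, 0 <= g t) ->
  measurable_fun [set: _] f -> measurable_fun [set: _] g ->
  (forall t, (forall i, G (tnth t i)) -> f t <= g t) -> iint PY f <= iint PY g.
Proof.
move=> aeG; elim: n f g => [|n ih] f g f0 g0 mf mg fg /=; first by apply: fg => -[].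
apply: ae_ge0_le_integral => //.
- by move=> y _; exact: iint_ge0.
- exact: measurable_iint_cons.
- by move=> y _; exact: iint_ge0.
- exact: measurable_iint_cons.
apply: filterS aeG => y Gy _; apply: ih => //.
- by apply: (measurableT_comp mf); exact: measurable_cons1.
- by apply: (measurableT_comp mg); exact: measurable_cons1.
- move=> t Gt; apply: fg => i; case: (unliftP ord0 i) => [j ->|->].
    by rewrite tnthS.
  by rewrite tnth0.
Qed.

Lemma iintD n (f g : n.-tuple TY -> \bar R) :
  (forall t, 0 <= f t) -> (forall t, 0 <= g t) ->
  measurable_fun [set: _] f -> measurable_fun [set: _] g ->
  iint PY (fun t => f t + g t) = iint PY f + iint PY g.
Proof.
elim: n f g => [//|n ih] f g f0 g0 mf mg /=.
rewrite -ge0_integralD//.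
- apply: eq_integral => y _; apply: ih => //.
  + by apply: (measurableT_comp mf); exact: measurable_cons1.
  + by apply: (measurableT_comp mg); exact: measurable_cons1.
- by move=> y _; exact: iint_ge0.
- exact: measurable_iint_cons.
- by move=> y _; exact: iint_ge0.
- exact: measurable_iint_cons.
Qed.

Lemma iintZl n (k : \bar R) (f : n.-tuple TY -> \bar R) : 0 <= k ->
  (forall t, 0 <= f t) -> measurable_fun [set: _] f ->
  iint PY (fun t => k * f t) = k * iint PY f.
Proof.
move=> k0; elim: n f => [//|n ih] f f0 mf /=.
rewrite -ge0_integralZl//.
- apply: eq_integral => y _; apply: ih => //.
  by apply: (measurableT_comp mf); exact: measurable_cons1.
- exact: measurable_iint_cons.
- by move=> y _; exact: iint_ge0.
Qed.

Lemma integral_prob_cst (k : \bar R) : \int[PY]_y k = k.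
Proof.
rewrite -[RHS]mule1 -(@probability_setT _ _ _ PY).
exact: (integral_cst PY measurableT k).
Qed.

Lemma iint_cst n (k : \bar R) : iint PY (fun _ : n.-tuple TY => k) = k.
Proof.
by elim: n => [//|n ih] /=; rewrite ih integral_prob_cst.
Qed.

Lemma measurable_tuple_sum n (f : TY -> \bar R) : measurable_fun [set: _] f ->
  measurable_fun [set: _] (fun t : n.-tuple TY => \sum_(i < n) f (tnth t i)).
Proof.
move=> mf; apply: emeasurable_sum => i.
by apply: (measurableT_comp mf); exact: measurable_tnth.
Qed.

Lemma iint_sum n (f : TY -> \bar R) : (forall y, 0 <= f y) -> measurable_fun [set: _] f ->
  iint PY (fun t : n.-tuple TY => \sum_(i < n) f (tnth t i)) = n%:R%:E * \int[PY]_y f y.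
Proof.
move=> f0 mf; elim: n => [|n ih] /=; first by rewrite big_ord0 mul0e.
under eq_integral => y _.
  under eq_fun => t.
    rewrite big_ord_recl tnth0; under eq_bigr do rewrite tnthS.
    over.
  rewrite iintD//; last 2 first.
    by move=> t; exact: sume_ge0.
    exact: measurable_tuple_sum.
  rewrite iint_cst ih.
  over.
have I0 : 0 <= \int[PY]_y f y by apply: integral_ge0.
rewrite ge0_integralD//; last by move=> y _; rewrite mule_ge0.
rewrite integral_prob_cst.
by rewrite -natr1 EFinD addeC ge0_muleDl// mul1e.
Qed.

End iterated_integral.

(** * Mean of the square root of a sum *)

Section sqrt_moments.
Context {R : realType} {d : measure_display} {TY : measurableType d}.
Variables (PY : probability TY R) (v : TY -> R) (m M : R).
Hypotheses (mv : measurable_fun [set: TY] v) (v0 : forall y, 0 <= v y) (m0 : 0 <= m).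
Hypothesis vm : (\int[PY]_y (v y)%:E = m%:E)%E.

Let mEv : measurable_fun [set: TY] (fun y => (v y)%:E).
Proof. exact/measurable_EFinP. Qed.

Let sum_v0 n (t : n.-tuple TY) : 0 <= \sum_(i < n) v (tnth t i).
Proof. by apply: sumr_ge0. Qed.

Lemma measurable_sqrt_sum x n :
  measurable_fun [set: n.-tuple TY] (fun t => (Num.sqrt (x + \sum_(i < n) v (tnth t i)))%:E).
Proof.
apply/measurable_EFinP.
apply: (measurableT_comp (continuous_measurable_fun (@sqrt_continuous R))).
apply: measurable_funD => //; apply: measurable_sum => i.
by apply: (measurableT_comp mv); exact: measurable_tnth.
Qed.

Lemma iint_sum_v n :
  (iint PY (fun t : n.-tuple TY => (\sum_(i < n) v (tnth t i))%:E) = (n%:R * m)%:E)%E.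
Proof.
rewrite EFinM -vm -(@iint_sum _ _ _ PY n (fun y => (v y)%:E))//.
by congr (iint PY); apply/funext => t; rewrite sumEFin.
Qed.

(** Jensen's inequality, through the tangent of the square root at the mean: a <= (a^2 + b^2) / (2
    b), where b^2 is the mean of a^2. *)
Lemma iint_sqrt_le n :
  (iint PY (fun t : n.-tuple TY => (Num.sqrt (1 + \sum_(i < n) v (tnth t i)))%:E)
   <= (Num.sqrt (1 + n%:R * m))%:E)%E.
Proof.
set B := 1 + n%:R * m; have B0 : 0 < B by rewrite ltr_wpDr// mulr_ge0.
set b := Num.sqrt B; have b0 : 0 < b by rewrite sqrtr_gt0.
have k0 : 0 <= (2 * b)^-1 by rewrite invr_ge0 mulr_ge0// ltW.
pose S (t : n.-tuple TY) := \sum_(i < n) v (tnth t i).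
have mS : measurable_fun [set: n.-tuple TY] (fun t => (S t)%:E).
  apply/measurable_EFinP; apply: measurable_sum => i.
  by apply: (measurableT_comp mv); exact: measurable_tnth.
apply: (@le_trans _ _ (iint PY (fun t => ((2 * b)^-1 + b / 2)%:E + (2 * b)^-1%:E * (S t)%:E)%E)).
  apply: (@iint_le _ _ _ _ _ setT) => //.
  - exact: filterE.
  - move=> t; rewrite -EFinM -EFinD lee_fin addr_ge0 ?mulr_ge0 ?sum_v0//.
    by rewrite addr_ge0// divr_ge0// ltW.
  - exact: measurable_sqrt_sum.
  - by apply: emeasurable_funD => //; apply: measurable_funeM.
  move=> t _; rewrite -EFinM -EFinD lee_fin -/(S t).
  have S0 : 0 <= 1 + S t by rewrite addr_ge0// sum_v0.
  set a := Num.sqrt _; have a2 : a ^+ 2 = 1 + S t by rewrite sqr_sqrtr.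
  have -> : (2 * b)^-1 + b / 2 + (2 * b)^-1 * S t = (a ^+ 2 + b ^+ 2) / (2 * b).
    by rewrite a2; field; rewrite gt_eqF.
  rewrite ler_pdivlMr ?mulr_gt0//; have := sqr_ge0 (a - b); nra.
rewrite iintD//.
- rewrite iint_cst iintZl// ?iint_sum_v; last by move=> t; rewrite lee_fin sum_v0.
  rewrite -EFinM -EFinD lee_fin.
  have b2 : b ^+ 2 = 1 + n%:R * m by rewrite sqr_sqrtr ?ltW.
  have -> : (2 * b)^-1 + b / 2 + (2 * b)^-1 * (n%:R * m) = (b ^+ 2 + b ^+ 2) / (2 * b).
    by rewrite {2}b2; field; rewrite gt_eqF.
  by rewrite ler_pdivrMr ?mulr_gt0//; lra.
- by move=> t; rewrite lee_fin addr_ge0// divr_ge0// ltW.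
- by move=> t; rewrite mule_ge0// lee_fin// sum_v0.
- by apply: measurable_funeM.
Qed.

Hypotheses (aeM : \forall y \ae PY, v y <= M) (mM : m <= M).

(** With x, y the two roots, the difference of the sides factors as (x - y)^2 ((x + y)^2 - y^2) / (2
    y^3), so the bound holds for all a >= 0, however far from b. *)
Lemma sqrt_second_order a b : 0 <= a -> 0 < b ->
  Num.sqrt b + (a - b) / (2 * Num.sqrt b) - (a - b) ^+ 2 / (2 * (b * Num.sqrt b)) <= Num.sqrt a :> R.
Proof.
move=> a0 b0; set x := Num.sqrt a; set y := Num.sqrt b.
have y0 : 0 < y by rewrite sqrtr_gt0.
have x0 : 0 <= x by rewrite sqrtr_ge0.
have -> : a = x ^+ 2 by rewrite sqr_sqrtr.
have -> : b = y ^+ 2 by rewrite sqr_sqrtr// ltW.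
rewrite -subr_ge0.
have -> : x - (y + (x ^+ 2 - y ^+ 2) / (2 * y) - (x ^+ 2 - y ^+ 2) ^+ 2 / (2 * (y ^+ 2 * y))) =
  (x - y) ^+ 2 * ((x + y) ^+ 2 - y ^+ 2) / (2 * (y ^+ 2 * y)).
  by field; rewrite gt_eqF.
apply: divr_ge0; last by rewrite mulr_ge0// mulr_ge0 ?sqr_ge0// ltW.
rewrite mulr_ge0 ?sqr_ge0//.
by rewrite subr_ge0 lerXn2r ?nnegrE ?addr_ge0 ?(ltW y0)// lerDr.
Qed.

(** The k-th summand is the cost of replacing one [v y] by its mean while k further letters
    contribute at least m k under the root. *)
Definition sqrt_err (n : nat) : R := \sum_(k < n) M ^+ 2 / (1 + m * k%:R).

(** Induction with x arbitrary: the first [v y] joins x, the induction hypothesis averages the other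
    letters, and [sqrt_second_order] replaces [v y] by m. The linear term has mean zero. *)
Lemma iint_sqrt_ge n x : 1 <= x ->
  ((Num.sqrt (x + n%:R * m))%:E <=
   iint PY (fun t : n.-tuple TY => (Num.sqrt (x + \sum_(i < n) v (tnth t i)))%:E)
   + (sqrt_err n)%:E)%E.
Proof.
elim: n x => [|n ih] x x1.
  by rewrite /sqrt_err /= !big_ord0 mul0r adde0.
set b := x + n.+1%:R * m.
have nm0 : 0 <= n%:R * m by rewrite mulr_ge0.
have b1 : 1 + m * n%:R <= b.
  have -> : b = x + (n%:R * m + m) by rewrite /b -natr1; ring.
  by rewrite (mulrC m); have := m0; have := x1; lra.
have b0 : 0 < b by apply: lt_le_trans b1; rewrite ltr_wpDr// mulr_ge0.
have sb1 : 1 <= Num.sqrt b.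
  by rewrite -[leLHS]sqrtr1 ler_wsqrtr// (le_trans _ b1)// lerDl mulr_ge0.
have sb0 : 0 < Num.sqrt b by exact: lt_le_trans sb1.
have e0 k : 0 <= M ^+ 2 / (1 + m * k%:R).
  by rewrite divr_ge0 ?sqr_ge0// addr_ge0// mulr_ge0.
have err0 k : 0 <= sqrt_err k by apply: sumr_ge0 => i _; exact: e0.
pose k := (2 * Num.sqrt b)^-1; have k0 : 0 <= k by rewrite invr_ge0 mulr_ge0// ltW.
pose F y := iint PY (fun t : n.-tuple TY => (Num.sqrt (x + v y + \sum_(i < n) v (tnth t i)))%:E).
have FE : iint PY (fun t : n.+1.-tuple TY => (Num.sqrt (x + \sum_(i < n.+1) v (tnth t i)))%:E) =
    (\int[PY]_y F y)%E.
  apply: eq_integral => y _; rewrite /F; congr (iint PY); apply/funext => t.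
  by rewrite big_ord_recl tnth0 addrA; under eq_bigr do rewrite tnthS.
have F0 y : (0 <= F y)%E by apply: iint_ge0 => t; rewrite lee_fin.
have mF : measurable_fun [set: TY] F.
  have := @measurable_iint_cons _ _ _ PY n
    (fun t : n.+1.-tuple TY => (Num.sqrt (x + \sum_(i < n.+1) v (tnth t i)))%:E).
  rewrite (_ : (fun y => iint PY _) = F).
    by apply => [t|]; [rewrite lee_fin|exact: measurable_sqrt_sum].
  apply/funext => y; rewrite /F; congr (iint PY); apply/funext => t.
  by rewrite big_ord_recl tnth0 addrA; under eq_bigr do rewrite tnthS.
rewrite FE.
(* The term k m turns the linear part k (v - m) into k v on the left, so that both integrands are
   nonnegative. *)
set E := sqrt_err n.+1 + k * m.
have E0 : 0 <= E by rewrite addr_ge0// mulr_ge0.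
have : (\int[PY]_y ((Num.sqrt b)%:E + k%:E * (v y)%:E) <= \int[PY]_y (F y + E%:E))%E.
  apply: ae_ge0_le_integral => //.
  - by move=> y _; rewrite adde_ge0 ?mule_ge0 ?lee_fin// ltW.
  - by apply: emeasurable_funD => //; apply: measurable_funeM.
  - by move=> y _; rewrite adde_ge0 ?lee_fin.
  - exact: emeasurable_funD.
  apply: filterS aeM => y vM _.
  have x'1 : 1 <= x + v y by rewrite (le_trans x1)// lerDl.
  have := ih (x + v y) x'1; rewrite -/(F y) => h.
  rewrite /E (_ : sqrt_err n.+1 = sqrt_err n + M ^+ 2 / (1 + m * n%:R)); last first.
    by rewrite /sqrt_err big_ord_recr.
  rewrite -addrA EFinD addeA.
  apply: le_trans (leeD2r _ h); rewrite -EFinM -!EFinD lee_fin.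
  have a0 : 0 <= x + v y + n%:R * m by rewrite addr_ge0// (le_trans _ x'1).
  have := sqrt_second_order a0 b0.
  have -> : x + v y + n%:R * m - b = v y - m by rewrite /b -natr1; ring.
  have : (v y - m) ^+ 2 / (2 * (b * Num.sqrt b)) <= M ^+ 2 / (1 + m * n%:R).
    rewrite ler_pM ?sqr_ge0 ?invr_ge0//.
    - by rewrite mulr_ge0// mulr_ge0 ?sqrtr_ge0// ltW.
    - rewrite -(real_normK (num_real (v y - m))) lerXn2r ?nnegrE//.
        by rewrite (le_trans m0).
      rewrite ler_norml; apply/andP; split; last by rewrite lerBlDr (le_trans vM)// lerDl.
      by rewrite lerNl opprB lerBlDr (le_trans mM)// lerDl.
    rewrite lef_pV2 ?posrE ?mulr_gt0//; last by rewrite ltr_wpDr// mulr_ge0.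
    by rewrite (le_trans b1)//; nra.
  by rewrite -/k mulrBl mulrC -/k (mulrC m); lra.
rewrite ge0_integralD//; last 2 first.
- by move=> y _; rewrite mule_ge0 ?lee_fin.
- by apply: measurable_funeM.
rewrite ge0_integralD//.
rewrite !integral_prob_cst ge0_integralZl//; last by move=> y _; rewrite lee_fin.
rewrite vm -EFinM /E EFinD addeA leeD2rE//.
Qed.

End sqrt_moments.

(** * Shell codes *)

Definition bits (m i : nat) : seq bool := nth [::] [seq tval t | t <- enum {: m.-tuple bool}] i.

Lemma size_bits m i : (i < 2 ^ m)%N -> size (bits m i) = m.
Proof.
move=> im; rewrite /bits (nth_map (nseq_tuple m true)) ?size_tuple//.
by rewrite -?cardT card_tuple card_bool.
Qed.

Lemma bits_inj m i j : (i < 2 ^ m)%N -> (j < 2 ^ m)%N -> bits m i = bits m j -> i = j.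
Proof.
have sz : size [seq tval t | t <- enum {: m.-tuple bool}] = (2 ^ m)%N.
  by rewrite size_map -?cardT card_tuple card_bool.
have u : uniq [seq tval t | t <- enum {: m.-tuple bool}].
  by rewrite map_inj_uniq ?enum_uniq//; exact: val_inj.
by move=> im jm /eqP; rewrite nth_uniq ?sz// => /eqP.
Qed.

(** * Completing a sub-probability to a probability *)

Section completion.
Context {R : realType} {J : countType} (j0 : J).
Implicit Type f : J -> R.

Definition deficit f : R := 1 - fine (\esum_(j in [set: J]) (f j)%:E)%E.

(** All the missing mass goes to [j0]: the empty string for the encoder, which costs no length, and
    an arbitrary block for the decoder. *)
Definition complete f (j : J) : R := f j + (j == j0)%:R * deficit f.

Variable f : J -> R.
Hypotheses (f0 : forall j, 0 <= f j) (f1 : (\esum_(j in [set: J]) (f j)%:E <= 1)%E).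

Let fE : (\esum_(j in [set: J]) (f j)%:E = (fine (\esum_(j in [set: J]) (f j)%:E))%:E)%E.
Proof.
rewrite fineK// ge0_fin_numE ?(le_lt_trans f1) ?ltry//.
by apply: esum_ge0 => j _; rewrite lee_fin.
Qed.

Lemma deficit_ge0 : 0 <= deficit f.
Proof. by rewrite subr_ge0 -lee_fin -fE. Qed.

Lemma complete_ge j : f j <= complete f j.
Proof. by rewrite lerDl mulr_ge0// deficit_ge0. Qed.

Lemma complete_ge0 j : 0 <= complete f j.
Proof. exact: le_trans (complete_ge j). Qed.

Lemma complete_sum1 : (\esum_(j in [set: J]) (complete f j)%:E = 1)%E.
Proof.
have -> : (\esum_(j in [set: J]) (complete f j)%:E =
    \esum_(j in [set: J]) (f j)%:E + \esum_(j in [set: J]) ((j == j0)%:R * deficit f)%:E)%E.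
  rewrite -esumD; first by apply: eq_esum => j _; rewrite -EFinD.
    by move=> j _; rewrite lee_fin.
  by move=> j _; rewrite lee_fin mulr_ge0// deficit_ge0.
rewrite [X in (_ + X)%E](esumID [set j0]); last first.
  by move=> j _; rewrite lee_fin mulr_ge0// deficit_ge0.
rewrite setTI esum_set1; last by rewrite lee_fin mulr_ge0// deficit_ge0.
rewrite [X in (_ + (_ + X))%E]esum1 ?adde0 ?eqxx ?mul1r; last first.
  by move=> j [_ /eqP/negPf ->]; rewrite mul0r.
by rewrite fE -EFinD /deficit addrC subrK.
Qed.

End completion.

Lemma pmf_le1 {R : realType} {J : choiceType} (f : J -> R) (j : J) : (forall j, 0 <= f j) ->
  (\esum_(j in [set: J]) (f j)%:E <= 1)%E -> f j <= 1.
Proof.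
move=> f0; rewrite -lee_fin => /(le_trans _); apply.
rewrite (esumID [set j]); last by move=> i _; rewrite lee_fin.
by rewrite setTI esum_set1 ?lee_fin// leeDl// esum_ge0// => i _; rewrite lee_fin.
Qed.

(** * Dyadic shells of a probability mass function *)

Section shells.
Context {R : realType} {I : countType}.
Implicit Type P : I -> R.

Definition shell P m x : bool := (2^-1 ^+ m <= P x) && (P x < 2 * 2^-1 ^+ m).

Definition index_in_shell P m (x : I) : nat :=
  (\sum_(k < pickle x) oapp (shell P m) false (pickle_inv k))%N.

(** The code is kept as a relation between elements and strings: an element of probability zero has
    no codeword, and measurability in [P] can be read off the formula. *)
Definition is_codeword P x b : bool :=
  shell P (size b) x && (bits (size b) (index_in_shell P (size b) x) == b).

Variable P : I -> R.
Hypotheses (P0 : forall x, 0 <= P x) (P1 : (\esum_(x in [set: I]) (P x)%:E = 1)%E).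

Let half_gt0 m : 0 < 2^-1 ^+ m :> R. Proof. by rewrite exprn_gt0. Qed.

Lemma shell_uniq m m' x : shell P m x -> shell P m' x -> m = m'.
Proof.
wlog mm' : m m' / (m <= m')%N.
  by move=> h; have [/h//|/ltnW mm' a b] := leqP m m'; apply/esym/h.
move=> /andP[h1 _] /andP[_ h2]; apply/eqP; rewrite eqn_leq mm' leqNgt; apply/negP => lt.
have := le_lt_trans h1 h2; rewrite ltNge => /negP; apply.
have -> : 2 * 2^-1 ^+ m' = 2^-1 ^+ m'.-1 :> R.
  by case: m' lt {mm' h2} => // m' _; rewrite exprS mulrA mulfV ?mul1r.
rewrite ler_wiXn2l ?invr_ge0// ?invf_le1 ?ler1n//.
by case: m' lt {mm' h2}.
Qed.

Lemma shell_exists x : 0 < P x -> exists m, shell P m x.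
Proof.
move=> px.
have ex : exists m, 2^-1 ^+ m <= P x.
  (* Any integer above 1 / P x will do, as k < 2^k; the shell index is then the least admissible
     exponent. *)
  exists (Num.bound (P x)^-1); rewrite exprVn -[leRHS]invrK lef_pV2 ?posrE ?exprn_gt0 ?invr_gt0//.
  apply: (@le_trans _ _ (Num.bound (P x)^-1)%:R).
    by rewrite ltW// archi_boundP ?invr_ge0.
  by rewrite -natrX ler_nat ltnW// ltn_expl.
exists (ex_minn ex); case: ex_minnP => m hm mmin; rewrite /shell hm/=.
case: m mmin hm => [|m] mmin hm.
  by rewrite expr0 mulr1 (le_lt_trans (pmf_le1 _ P0 _)) ?P1// ltr1n.
rewrite exprS mulrA mulfV// mul1r ltNge; apply/negP => /mmin.
by rewrite ltnn.
Qed.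

Lemma shell_gt0 m x : shell P m x -> 0 < P x.
Proof. by move=> /andP[+ _]; apply: lt_le_trans. Qed.

Lemma index_in_shell_lt m x y : (pickle x < pickle y)%N -> shell P m x ->
  (index_in_shell P m x < index_in_shell P m y)%N.
Proof.
move=> xy sx; rewrite /index_in_shell.
pose F k : nat := oapp (shell P m) false (@pickle_inv I k).
rewrite -!(big_mkord xpredT F).
rewrite (@big_cat_nat _ _ _ (pickle x).+1 0 (pickle y))//= big_nat_recr//=.
by rewrite /F pickleK_inv/= sx -addnA addnCA add1n ltnS leq_addr.
Qed.

(** Each element of the shell has mass at least 2^-m, so there are at most 2^m of them and the
    strings of length m suffice to number them. *)
Lemma index_in_shell_bound m x : shell P m x -> (index_in_shell P m x < 2 ^ m)%N.
Proof.
move=> sx; pose F k : nat := oapp (shell P m) false (@pickle_inv I k).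
have e : (index_in_shell P m x).+1 = (\sum_(0 <= k < (pickle x).+1) F k)%N.
  by rewrite big_nat_recr//= /F pickleK_inv /= sx addn1 /index_in_shell big_mkord.
rewrite e; set S := (\sum_(0 <= k < _) _)%N.
suff : (S%:R * 2^-1 ^+ m <= 1 :> R).
  by rewrite exprVn ler_pdivrMr ?exprn_gt0// mul1r -natrX ler_nat.
rewrite -lee_fin -P1 esum_nneseries//.
apply: (@le_trans _ _ (\sum_(0 <= k < (pickle x).+1) oapp (fun i => (P i)%:E) 0%E (@pickle_inv I k))%E).
  rewrite /S natr_sum big_distrl/= -sumEFin; apply: lee_sum => k _.
  rewrite /F; case: (@pickle_inv I k) => [i|] /=; last by rewrite mul0r.
  have [/andP[si _]|_] := boolP (shell P m i); first by rewrite mul1r lee_fin.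
  by rewrite mul0r lee_fin.
by apply: nneseries_lim_ge => k _ _; case: pickle_inv => //= i; rewrite lee_fin.
Qed.

Lemma is_codeword_inj x y b : is_codeword P x b -> is_codeword P y b -> x = y.
Proof.
move=> /andP[sx /eqP ex] /andP[sy /eqP ey]; have {}ex := etrans ex (esym ey).
have {}ex := bits_inj (index_in_shell_bound sx) (index_in_shell_bound sy) ex.
have xy : pickle x = pickle y; last exact: (@pcan_inj _ _ (@pickle I) (@pickle_inv I) (@pickleK_inv I) _ _ xy).
have [/index_in_shell_lt/(_ sx)|/index_in_shell_lt/(_ sy)|//] := ltngtP (pickle x) (pickle y).
  by rewrite ex ltnn.
by rewrite ex ltnn.
Qed.

Lemma is_codeword_exists m x : shell P m x ->
  let b := bits m (index_in_shell P m x) in size b = m /\ is_codeword P x b.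
Proof.
move=> sx; rewrite /is_codeword size_bits ?eqxx ?sx ?index_in_shell_bound//.
Qed.

Lemma is_codeword_uniq x b b' : is_codeword P x b -> is_codeword P x b' -> b = b'.
Proof.
move=> /andP[sx /eqP <-] /andP[sy /eqP <-].
by rewrite (shell_uniq sx sy).
Qed.

(** Refers to the index of the shell: these are the more likely elements, those of the shells before
    m. *)
Definition below P m x : bool := 2 * 2^-1 ^+ m <= P x.

Definition mass P (A : pred I) : R := fine (Ex P (fun x => (A x)%:R)).

Lemma massE (A : pred I) : Ex P (fun x => (A x)%:R) = (mass P A)%:E.
Proof.
have le1 : (Ex P (fun x => (A x)%:R) <= 1)%E.
  rewrite -P1; apply: le_esum => x _; rewrite lee_fin ler_piMr//.
  by rewrite lern1 leq_b1.
by rewrite /mass fineK// ge0_fin_numE ?(le_lt_trans le1) ?ltry// Ex_ge0.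
Qed.

Lemma mass_ge0 A : 0 <= mass P A.
Proof. by rewrite fine_ge0// Ex_ge0. Qed.

Lemma mass_le1 A : mass P A <= 1.
Proof.
rewrite -lee_fin -massE -P1; apply: le_esum => x _; rewrite lee_fin ler_piMr//.
by rewrite lern1 leq_b1.
Qed.

Lemma belowS m x : (below P m.+1 x)%:R = (below P m x)%:R + (shell P m x)%:R :> R.
Proof.
rewrite /below /shell exprS mulrA mulfV// mul1r.
have h := half_gt0 m.
have [b1|b1] := leP (2 * 2^-1 ^+ m) (P x); have [b2|b2] := leP (2^-1 ^+ m) (P x);
  rewrite ?addr0 ?add0r//; exfalso; lra.
Qed.

Lemma mass_belowS m : mass P (below P m.+1) = mass P (below P m) + mass P (shell P m).
Proof.
apply: EFin_inj; rewrite -massE EFinD -!massE -ExD//.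
by apply: eq_Ex => x _; rewrite belowS.
Qed.

Lemma mass_below0 : mass P (below P 0) = 0.
Proof.
apply: EFin_inj; rewrite -massE /Ex esum1// => x _.
rewrite /below expr0 mulr1 leNgt (le_lt_trans (pmf_le1 x P0 _)) ?P1// ?ltr1n//.
by rewrite mulr0.
Qed.

Lemma mass_below_le m m' : (m <= m')%N -> mass P (below P m) <= mass P (below P m').
Proof.
move=> /subnK <-; elim: (m' - m)%N => [//|k ih].
by rewrite addSn mass_belowS (le_trans ih)// lerDl mass_ge0.
Qed.

Lemma mass_shell_gt0 m x : shell P m x -> 0 < mass P (shell P m).
Proof.
move=> sx; apply: (lt_le_trans (shell_gt0 sx)).
rewrite -lee_fin -massE /Ex (esumID [set x]); last by move=> i _; rewrite lee_fin mulr_ge0.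
rewrite setTI esum_set1 ?lee_fin ?mulr_ge0// sx mulr1 leeDl// esum_ge0// => i _.
by rewrite lee_fin mulr_ge0.
Qed.

(** Finitely many elements already carry more than [a]; the largest of their shell indices gives
    m. *)
Lemma mass_below_large (a : R) : a < 1 -> exists m, a <= mass P (below P m).
Proof.
move=> a1; have : (a%:E < \esum_(x in [set: I]) (P x)%:E)%E by rewrite P1 lte_fin.
move=> /ereal_sup_gt[_ [X [finX _] <-]] aX.
have [m hm] : exists m, forall x, X x -> 0 < P x -> below P m x.
  have /choice[g hg] : forall x, exists m, 0 < P x -> below P m x.
    move=> x; have [px|px] := ltP 0 (P x); last by exists 0%N.
    have [m /andP[sm _]] := shell_exists px; exists m.+1 => _.
    by rewrite /below exprS mulrA mulfV// mul1r.
  have [F XF] := (@finite_seqP _ X).1 finX.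
  exists (\max_(x <- F) g x) => x; rewrite XF => xF px.
  apply: le_trans (hg x px); rewrite ler_wpM2l// ler_wiXn2l ?invr_ge0// ?invf_le1 ?ler1n//.
  by apply: (leq_bigmax_seq x).
exists m; rewrite -lee_fin -massE; apply: (le_trans (ltW aX)).
apply: esum_ge; exists X => //; apply: lee_fsum => // x Xx.
have [px|] := ltP 0 (P x); first by rewrite hm// mulr1.
by move=> px; rewrite lee_fin (le_trans px)// mulr_ge0.
Qed.

Variable alpha : R.
Hypotheses (alpha0 : 0 <= alpha) (alpha1 : alpha <= 1).

(** The fraction of shell m to keep so that the total kept mass is alpha: 1 before the cutoff shell,
    0 after it. A clipped quotient is measurable in [P] without a measurable choice of the cutoff;
    an empty shell gets 0, by division by zero. *)
Definition keep_prob P m : R :=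
  Num.max 0 (Num.min 1 ((alpha - mass P (below P m)) / mass P (shell P m))).

Definition enc_sub P x b : R := keep_prob P (size b) * (is_codeword P x b)%:R.

Definition kept P x : R := fine (\esum_(b in [set: seq bool]) (enc_sub P x b)%:E)%E.

Lemma keep_prob_ge0 m : 0 <= keep_prob P m.
Proof. by rewrite le_max lexx. Qed.

Lemma keep_prob_le1 m : keep_prob P m <= 1.
Proof. by rewrite ge_max ler01/= ge_min lexx. Qed.

Lemma enc_sub_ge0 x b : 0 <= enc_sub P x b.
Proof. by rewrite mulr_ge0// keep_prob_ge0. Qed.

Lemma esum_codeword m x (g : seq bool -> R) : (forall b, 0 <= g b) -> shell P m x ->
  (\esum_(b in [set: seq bool]) (g b * (is_codeword P x b)%:R)%:E =
   (g (bits m (index_in_shell P m x)))%:E)%E.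
Proof.
move=> g0 sx; have [_ cb] := is_codeword_exists sx; set b0 := bits _ _ in cb *.
rewrite (esumID [set b0]); last by move=> b _; rewrite lee_fin mulr_ge0.
rewrite setTI esum_set1 ?lee_fin ?mulr_ge0// cb mulr1 esum1 ?adde0//.
move=> b [_ /= bb0]; have [cb'|_] := boolP (is_codeword P x b); last by rewrite mulr0.
by exfalso; apply: bb0; exact: is_codeword_uniq cb' cb.
Qed.

Lemma kept_shell m x : shell P m x -> kept P x = keep_prob P m.
Proof.
move=> sx; rewrite /kept (esum_codeword (g := fun b => keep_prob P (size b)) _ sx).
  by have [-> _] := is_codeword_exists sx.
by move=> b; exact: keep_prob_ge0.
Qed.

Lemma no_codeword x b : P x = 0 -> is_codeword P x b = false.
Proof. by move=> px; apply/negP => /andP[/shell_gt0]; rewrite px ltxx. Qed.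

Lemma enc_sub_sum x : (\esum_(b in [set: seq bool]) (enc_sub P x b)%:E = (kept P x)%:E)%E.
Proof.
have := P0 x; rewrite le_eqVlt => /predU1P[/esym px|px].
  rewrite /kept; have -> : (\esum_(b in [set: seq bool]) (enc_sub P x b)%:E = 0)%E.
    by apply: esum1 => b _; rewrite /enc_sub no_codeword// mulr0.
  by [].
have [m sx] := shell_exists px; rewrite /kept /enc_sub.
by rewrite (esum_codeword (g := fun b => keep_prob P (size b)) _ sx)// => b; exact: keep_prob_ge0.
Qed.

Lemma kept_bounds x : 0 <= kept P x <= 1.
Proof.
have := P0 x; rewrite le_eqVlt => /predU1P[/esym px|px].
  have -> : kept P x = 0.
    by apply: EFin_inj; rewrite -enc_sub_sum esum1// => b _; rewrite /enc_sub no_codeword// mulr0.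
  by rewrite lexx ler01.
have [m sx] := shell_exists px.
by rewrite (kept_shell sx) keep_prob_ge0 keep_prob_le1.
Qed.

(** At alpha = 1 infinitely many shells may be nonempty and no cutoff need exist; [kept_alpha1]
    covers that case. *)
Lemma cutoff : alpha < 1 -> exists t,
  mass P (below P t) <= alpha <= mass P (below P t) + mass P (shell P t).
Proof.
move=> a1; have [m hm] := mass_below_large a1.
have ex : exists m, alpha <= mass P (below P m.+1).
  by exists m; rewrite (le_trans hm)// mass_below_le.
exists (ex_minn ex); case: ex_minnP => t ht tmin; rewrite -mass_belowS ht andbT.
case: t tmin ht => [|t] tmin _; first by rewrite mass_below0.
by rewrite leNgt; apply/negP => /ltW /tmin; rewrite ltnn.
Qed.

Section with_cutoff.
Variable t : nat.
Hypothesis ht : mass P (below P t) <= alpha <= mass P (below P t) + mass P (shell P t).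

Lemma keep_prob_lt m x : (m < t)%N -> shell P m x -> keep_prob P m = 1.
Proof.
move=> mt sx; have s0 := mass_shell_gt0 sx; have /andP[ht1 _] := ht.
rewrite /keep_prob min_l ?max_r// ler_pdivlMr// mul1r lerBrDl -mass_belowS.
exact: le_trans (mass_below_le mt) ht1.
Qed.

Lemma keep_prob_gt m : (t < m)%N -> keep_prob P m = 0.
Proof.
move=> tm; have /andP[_ ht2] := ht; rewrite /keep_prob max_l//.
rewrite ge_min; apply/orP; right; rewrite mulr_le0_ge0 ?invr_ge0 ?mass_ge0//.
by rewrite subr_le0 (le_trans ht2)// -mass_belowS mass_below_le.
Qed.

Lemma keep_prob_eq : keep_prob P t * mass P (shell P t) = alpha - mass P (below P t).
Proof.
have /andP[h1 h2] := ht; rewrite /keep_prob.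
have := mass_ge0 (shell P t); rewrite le_eqVlt => /predU1P[s0|s0].
  by rewrite -s0 mulr0; move: h2; rewrite -s0; lra.
rewrite min_r; last by rewrite ler_pdivrMr// mul1r; lra.
rewrite max_r; first by rewrite divfK// gt_eqF.
by rewrite divr_ge0 ?(ltW s0)// subr_ge0.
Qed.

Lemma kept_cutoff x : P x != 0 ->
  kept P x = (below P t x)%:R + keep_prob P t * (shell P t x)%:R.
Proof.
move=> px; have {}px : 0 < P x by rewrite lt_neqAle eq_sym px P0.
have [m sx] := shell_exists px; rewrite (kept_shell sx).
have bl k : below P k x = (m < k)%N.
  rewrite /below; have /andP[s1 s2] := sx; apply/idP/idP => [h|mk].
    rewrite ltnNge; apply/negP => km; have := le_lt_trans h s2; rewrite ltNge => /negP; apply.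
    by rewrite ler_wpM2l// ler_wiXn2l ?invr_ge0// ?invf_le1 ?ler1n.
  apply: le_trans s1; case: k mk => // k mk; rewrite exprS mulrA mulfV// mul1r.
  by rewrite ler_wiXn2l ?invr_ge0// ?invf_le1 ?ler1n.
have sh : shell P t x = (t == m).
  by apply/idP/eqP => [/shell_uniq/(_ sx)//|->].
rewrite bl sh; have [mt|tm|->] := ltngtP m t.
- by rewrite (keep_prob_lt mt sx) mulr0 addr0.
- by rewrite (keep_prob_gt tm) mulr0 addr0.
- by rewrite mulr1 add0r.
Qed.

Lemma Ex_kept : Ex P (kept P) = alpha%:E.
Proof.
rewrite (eq_Ex P _ _ kept_cutoff) ExD//; last by move=> x; rewrite mulr_ge0// keep_prob_ge0.
by rewrite ExZ ?keep_prob_ge0// !massE -EFinM keep_prob_eq -EFinD addrC subrK.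
Qed.

End with_cutoff.

Lemma kept_alpha1 x : alpha = 1 -> P x != 0 -> kept P x = 1.
Proof.
move=> a1 px; have {}px : 0 < P x by rewrite lt_neqAle eq_sym px P0.
have [m sx] := shell_exists px; rewrite (kept_shell sx); have s0 := mass_shell_gt0 sx.
rewrite /keep_prob min_l ?max_r// ler_pdivlMr// mul1r lerBrDl -mass_belowS a1.
exact: mass_le1.
Qed.

Lemma Ex_lost : Ex P (fun x => 1 - kept P x) = (1 - alpha)%:E.
Proof.
have E1 : (Ex P (kept P) + Ex P (fun x => 1 - kept P x)%R = 1)%E.
  rewrite -ExD//; last 2 first.
  - by move=> x; have /andP[] := kept_bounds x.
  - by move=> x; have /andP[_ ?] := kept_bounds x; rewrite subr_ge0.
  rewrite -(Ex_cst P 1 P0 P1 ler01); apply: eq_Ex => x _ /=.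
  by rewrite addrC subrK.
have : Ex P (kept P) = alpha%:E.
  have [a1|a1] := ltP alpha 1; first by have [t ht] := cutoff a1; exact: Ex_kept ht.
  have ea : alpha = 1 by apply/eqP; rewrite eq_le alpha1.
  by rewrite -(Ex_cst P _ P0 P1 alpha0) ea; apply: eq_Ex => x px; rewrite kept_alpha1.
move=> e; move: E1; rewrite e EFinB => <-.
by rewrite addeAC subee// add0e.
Qed.

Variables (Z : I -> R) (H : R).
Hypothesis Z0 : forall x, 0 <= Z x.
Hypothesis ZP : forall x, 0 < P x -> Z x = - ln (P x) / ln 2.
Hypothesis EZ : Ex P Z = H%:E.

Lemma shell_info m x : shell P m x -> m%:R - 1 < Z x <= m%:R.
Proof.
move=> sx; have px := shell_gt0 sx; have /andP[h1 h2] := sx.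
have l2 : 0 < ln 2 :> R by rewrite ln_gt0// ltr1n.
have lh : ln (2^-1 ^+ m) = - m%:R * ln 2 :> R.
  by rewrite lnXn ?invr_gt0// lnV ?posrE// mulNrn mulNr mulr_natl.
rewrite ZP// ltr_pdivlMr// ler_pdivrMr//; apply/andP; split.
  rewrite ltrNr -ltr_ln ?posrE ?mulr_gt0// lnM ?posrE// lh in h2 *; lra.
rewrite lerNl -ler_ln ?posrE// lh in h1 *; lra.
Qed.

(** The codeword of an element of shell m has length m, less than its information plus one. *)
Lemma enc_sub_len : (\esum_(x in [set: I]) \esum_(b in [set: seq bool])
    (P x * enc_sub P x b * (size b)%:R)%:E <= Ex P (fun x => kept P x * Z x)%R + 1)%E.
Proof.
rewrite -(Ex_cst P 1 P0 P1 ler01) -ExD//; last first.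
  by move=> x; rewrite mulr_ge0//; have /andP[] := kept_bounds x.
apply: le_esum => x _.
have := P0 x; rewrite le_eqVlt => /predU1P[/esym px|px].
  by rewrite esum1 ?px ?mul0r// => b _; rewrite !mul0r.
have [m sx] := shell_exists px; have /andP[z1 z2] := shell_info sx.
rewrite (eq_esum (b := fun b => (P x * keep_prob P (size b) * (size b)%:R * (is_codeword P x b)%:R)%:E)); last first.
  by move=> b _; rewrite /enc_sub; congr EFin; ring.
rewrite (esum_codeword (g := fun b => P x * keep_prob P (size b) * (size b)%:R) _ sx); last first.
  by move=> b; rewrite !mulr_ge0// keep_prob_ge0.
have [-> _] := is_codeword_exists sx; rewrite (kept_shell sx) lee_fin -mulrA ler_wpM2l ?(ltW px)//=.
have := keep_prob_ge0 m; have := keep_prob_le1 m; nra.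
Qed.

(** Pointwise, (Z - t)^+ + (1 - kept) t <= (1 - kept) Z + 1. Shells before t are kept and have Z <=
    t; shells after t are dropped and have Z > t; shell t, partly kept, has Z within one bit of t.
    The lost mass is 1 - alpha. *)
Lemma kept_info_cutoff : alpha < 1 -> exists t : R,
  (Ex P (fun x => kept P x * Z x)%R + (Ex P (fun x => Num.max 0 (Z x - t))%R
   + ((1 - alpha) * t)%:E) <= (H + 1)%:E)%E.
Proof.
move=> a1; have [t ht] := cutoff a1; exists t%:R.
have k1 x : 0 <= 1 - kept P x by have /andP[_ ?] := kept_bounds x; rewrite subr_ge0.
have k0 x : 0 <= kept P x by have /andP[] := kept_bounds x.
have m0 x : 0 <= Num.max 0 (Z x - t%:R) by rewrite le_max lexx.
have EZ2 : Ex P (fun x => kept P x * Z x + (1 - kept P x) * Z x) = H%:E.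
  by rewrite -EZ; apply: eq_Ex => x _; ring.
rewrite ExD// in EZ2; last 2 first.
- by move=> x; rewrite mulr_ge0.
- by move=> x; rewrite mulr_ge0.
rewrite EFinD -EZ2 -addeA leeD2l// mulrC EFinM -Ex_lost -ExZ//.
rewrite -(Ex_cst P 1 P0 P1 ler01) -!ExD//; last 2 first.
- by move=> x; rewrite mulr_ge0.
- by move=> x; rewrite mulr_ge0.
apply: Ex_le => // x px /=.
have [m sx] := shell_exists px; have /andP[z1 z2] := shell_info sx.
rewrite (kept_shell sx).
have kp0 := keep_prob_ge0 m; have kp1 := keep_prob_le1 m.
have [mt|tm|mt] := ltngtP m t.
- rewrite (keep_prob_lt ht mt sx) max_l; first by lra.
  by rewrite subr_le0 (le_trans z2)// ler_nat ltnW.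
- have tz : t%:R <= m%:R - 1 :> R by rewrite lerBrDr natr1 ler_nat.
  by rewrite (keep_prob_gt ht tm) max_r; lra.
- by rewrite -mt max_l; [nra|lra].
Qed.

Variable x0 : I.

Definition shell_enc P x b : R := complete [::] (enc_sub P x) b.
Definition shell_dec P b x : R := complete x0 (fun x => (is_codeword P x b)%:R) x.

Lemma enc_sub_sum_le1 x : (\esum_(b in [set: seq bool]) (enc_sub P x b)%:E <= 1)%E.
Proof. by rewrite enc_sub_sum lee_fin; have /andP[] := kept_bounds x. Qed.

Lemma dec_sub_sum_le1 b : (\esum_(x in [set: I]) ((is_codeword P x b)%:R : R)%:E <= 1)%E.
Proof.
have [[x cx]|nx] := pselect (exists x, is_codeword P x b).
  rewrite (esumID [set x]); last by move=> i _; rewrite lee_fin.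
  rewrite setTI esum_set1 ?lee_fin// cx esum1 ?adde0// => y [_ /= yx].
  have [cy|//] := boolP (is_codeword P y b).
  by exfalso; apply: yx; exact: is_codeword_inj cy cx.
rewrite esum1// => x _; case: (boolP (is_codeword P x b)) => // cx.
by exfalso; apply: nx; exists x.
Qed.

(** A string emitted as a codeword is decoded with certainty, so errors come only from the mass that
    completion puts on the empty string, 1 - [kept]. *)
Lemma shell_code_err : (\esum_(x in [set: I]) \esum_(b in [set: seq bool])
    (P x * shell_enc P x b * (1 - shell_dec P b x))%:E <= (1 - alpha)%:E)%E.
Proof.
rewrite -Ex_lost; apply: le_esum => x _.
have k1 : 0 <= 1 - kept P x by have /andP[_ ?] := kept_bounds x; rewrite subr_ge0.
apply: (@le_trans _ _ (\esum_(b in [set: seq bool]) ((b == [::])%:R * (P x * (1 - kept P x)))%:E)%E).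
  apply: le_esum => b _; rewrite lee_fin.
  have d1 : (is_codeword P x b)%:R <= shell_dec P b x.
    by apply: (complete_ge x0 (f := fun x => (is_codeword P x b)%:R)) => //; exact: dec_sub_sum_le1.
  have d0 : 0 <= shell_dec P b x by apply: le_trans d1.
  have -> : shell_enc P x b = enc_sub P x b + (b == [::])%:R * (1 - kept P x) by [].
  have e0 : enc_sub P x b * (1 - shell_dec P b x) <= 0.
    rewrite /enc_sub; move: d1; case: is_codeword => d1; last by rewrite mulr0 mul0r.
    by rewrite mulr_ge0_le0 ?mulr_ge0 ?keep_prob_ge0// subr_le0.
  have l0 : (b == [::])%:R * (1 - kept P x) * (1 - shell_dec P b x) <=
      (b == [::])%:R * (1 - kept P x).
    by rewrite ler_piMr ?mulr_ge0// lerBlDr lerDl.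
  rewrite [leRHS]mulrCA -mulrA ler_wpM2l//; lra.
rewrite (esumID [set [::]]); last by move=> b _; rewrite lee_fin !mulr_ge0.
rewrite setTI esum_set1 ?lee_fin ?mulr_ge0// eqxx mul1r esum1 ?adde0//.
by move=> b [_ /= /eqP/negPf ->]; rewrite mul0r.
Qed.

Lemma shell_code_len : (\esum_(x in [set: I]) \esum_(b in [set: seq bool])
    (P x * shell_enc P x b * (size b)%:R)%:E <= Ex P (fun x => kept P x * Z x)%R + 1)%E.
Proof.
apply: le_trans enc_sub_len; apply: le_esum => x _; apply: le_esum => b _.
rewrite lee_fin /shell_enc /complete; case: eqP => [->|_]; first by rewrite !mulr0.
by rewrite mul0r addr0.
Qed.

End shells.

(** * Measurability of the shell code in the side information *)

Section code_measurability.
Context {R : realType} {d : measure_display} {T : measurableType d} {I : countType}.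
Variable P : I -> T -> R.
Hypotheses (P0 : forall x t, 0 <= P x t)
  (P1 : forall t, (\esum_(x in [set: I]) (P x t)%:E = 1)%E)
  (mP : forall x, measurable_fun [set: T] (P x)).

Lemma measurable_natr_bool (B : T -> bool) : measurable_fun [set: T] B ->
  measurable_fun [set: T] (fun t => (B t)%:R : R).
Proof.
move=> mB; rewrite (_ : (fun t => _) = (fun t => if B t then 1 else 0)).
  exact: measurable_fun_ifT.
by apply/funext => t; case: (B t).
Qed.

Lemma measurable_shell m x : measurable_fun [set: T] (fun t => shell (P ^~ t) m x).
Proof.
apply: measurable_and; first exact: measurable_fun_ler.
exact: measurable_fun_ltr.
Qed.

Lemma measurable_below m x : measurable_fun [set: T] (fun t => below (P ^~ t) m x).
Proof. exact: measurable_fun_ler. Qed.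

Lemma measurable_index_in_shell m x :
  measurable_fun [set: T] (fun t => index_in_shell (P ^~ t) m x).
Proof.
rewrite /index_in_shell; elim: (pickle x) => [|n ih].
  by under eq_fun do rewrite big_ord0; exact: measurable_cst.
under eq_fun do rewrite big_ord_recr/=.
apply: measurable_fun_addn => //.
case: (@pickle_inv I n) => [i|] //=.
by apply: (@measurableT_comp _ _ _ _ _ _ nat_of_bool) => //; exact: measurable_shell.
Qed.

Lemma measurable_is_codeword x b : measurable_fun [set: T] (fun t => is_codeword (P ^~ t) x b).
Proof.
apply: measurable_and; first exact: measurable_shell.
apply: (@measurableT_comp _ _ _ _ _ _ (fun i => bits (size b) i == b)) => //.
exact: measurable_index_in_shell.
Qed.

Lemma measurable_mass (A : T -> pred I) : (forall x, measurable_fun [set: T] (fun t => A t x)) ->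
  measurable_fun [set: T] (fun t => mass (P ^~ t) (A t)).
Proof.
move=> mA; rewrite /mass /Ex; apply: (measurableT_comp (fine_measurable measurableT)).
apply: measurable_esum => [x t|x]; first by rewrite lee_fin mulr_ge0.
apply/measurable_EFinP; apply: measurable_funM => //.
exact: measurable_natr_bool.
Qed.

Lemma measurable_inv_ge0 (f : T -> R) : (forall t, 0 <= f t) -> measurable_fun [set: T] f ->
  measurable_fun [set: T] (fun t => (f t)^-1).
Proof.
move=> f0 mf; under eq_fun do rewrite -powR_inv1//.
by apply: (@measurableT_comp _ _ _ _ _ _ (@powR R ^~ (-1))) => //; exact: measurable_powR.
Qed.

Variables (alpha : R).
Hypotheses (alpha0 : 0 <= alpha) (alpha1 : alpha <= 1).

Lemma measurable_keep_prob m : measurable_fun [set: T] (fun t => keep_prob alpha (P ^~ t) m).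
Proof.
apply: measurable_maxr => //; apply: measurable_minr => //.
apply: measurable_funM.
  by apply: measurable_funB => //; apply: measurable_mass => x; exact: measurable_below.
apply: measurable_inv_ge0 => [t|]; first exact: mass_ge0.
by apply: measurable_mass => x; exact: measurable_shell.
Qed.

Lemma measurable_complete (J : countType) (j0 : J) (f : J -> T -> R) j :
  (forall j t, 0 <= f j t) -> (forall j, measurable_fun [set: T] (f j)) ->
  measurable_fun [set: T] (fun t => complete j0 (f ^~ t) j).
Proof.
move=> f0 mf; apply: measurable_funD => //; apply: measurable_funM => //.
apply: measurable_funB => //; apply: (measurableT_comp (fine_measurable measurableT)).
apply: measurable_esum => [x t|x]; first by rewrite lee_fin.
exact/measurable_EFinP.
Qed.

Lemma measurable_shell_enc x b :
  measurable_fun [set: T] (fun t => shell_enc alpha (P ^~ t) x b).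
Proof.
apply: (measurable_complete _ _ (f := fun b t => enc_sub alpha (P ^~ t) x b)).
  by move=> c t; exact: enc_sub_ge0.
move=> c; apply: measurable_funM; first exact: measurable_keep_prob.
by apply: measurable_natr_bool; exact: measurable_is_codeword.
Qed.

Lemma measurable_shell_dec x0 x b :
  measurable_fun [set: T] (fun t => shell_dec x0 (P ^~ t) b x).
Proof.
apply: (measurable_complete _ _ (f := fun x t => (is_codeword (P ^~ t) x b)%:R : R)) => //.
by move=> y; apply: measurable_natr_bool; exact: measurable_is_codeword.
Qed.

End code_measurability.

(** * Converse for a fixed side information *)

Section string_sums.
Context {R : realType}.

Lemma esum_bool_tuple_cst k (c : R) : 0 <= c ->
  (\esum_(t in [set: k.-tuple bool]) c%:E = (2 ^+ k * c)%:E)%E.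
Proof.
move=> c0; elim: k => [|k ih]; first by rewrite esum_tuple0 ?expr0 ?mul1r ?lee_fin.
rewrite esum_tupleS; last by move=> _; rewrite lee_fin.
have p0 : 0 <= 2 ^+ k * c by rewrite mulr_ge0.
under eq_esum do rewrite ih.
rewrite (esumID [set true]); last by move=> i _; rewrite lee_fin.
rewrite setTI esum_set1 ?lee_fin// (_ : _ `&` _ = [set false]).
  by rewrite esum_set1 ?lee_fin// -EFinD exprS; congr EFin; ring.
by apply/seteqP; split => -[]//= [_ /(_ erefl)].
Qed.

Lemma esum_seq_bool (f : nat -> R) : (forall k, 0 <= f k) ->
  (\esum_(b in [set: seq bool]) (f (size b))%:E = \esum_(k in [set: nat]) (2 ^+ k * f k)%:E)%E.
Proof.
move=> f0; have -> : [set: seq bool] = \bigcup_(k in [set: nat]) [set b | size b = k].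
  by apply/seteqP; split => // b _; exists (size b).
rewrite esum_bigcupT//; last by move=> b; rewrite lee_fin.
  apply: eq_esum => k _; rewrite -esum_bool_tuple_cst//.
  rewrite (@reindex_esum _ _ _ [set: k.-tuple bool] _ (fun t => tval t)).
    by apply: eq_esum => t _; rewrite size_tuple.
  split.
  - by move=> t _ /=; rewrite size_tuple.
  - by move=> t t' _ _; exact: val_inj.
  - by move=> b /= /eqP sb; exists (Tuple sb).
by move=> i j _ _ [b [/= <- <-]].
Qed.

Lemma esum_swap (I J : choiceType) (a : I -> J -> \bar R) : (forall i j, 0 <= a i j)%E ->
  (\esum_(i in [set: I]) \esum_(j in [set: J]) a i j =
   \esum_(j in [set: J]) \esum_(i in [set: I]) a i j)%E.
Proof.
move=> a0; rewrite !esum_esum//.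
rewrite (@reindex_esum _ _ _ ([set: J] `*`` (fun=> [set: I])) _ (fun k => (k.2, k.1)))//.
split => //; first by move=> [? ?] [? ?] _ _ /= [-> ->].
by move=> [i j] _; exists (j, i).
Qed.

Variables (N h : nat).

(** The exponent is |k - h|, since one of the two truncated differences is 0. The weights 2^-l alone
    give mass 1 to every length and infinite total mass. A ratio this close to 1 makes the total
    O(N) at a price of only about |k - h| / N in the logarithm. *)
Definition window (k : nat) : R := (N%:R / N.+1%:R) ^+ ((k - h) + (h - k)).

Lemma window_gt0 k : (0 < N)%N -> 0 < window k.
Proof. by move=> N0; rewrite exprn_gt0// divr_gt0// ltr0n. Qed.

(** Closed geometric sums on each side of the peak h, in a form stable under induction because N+1
    times the ratio is N. *)
Lemma window_partial_sum K : (0 < N)%N -> \sum_(0 <= k < K) window k <=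
  if (K <= h)%N then N.+1%:R * (N%:R / N.+1%:R) ^+ (h - K)
  else 2 * N.+1%:R - N.+1%:R * (N%:R / N.+1%:R) ^+ (K - h) :> R.
Proof.
move=> N0; set r := N%:R / N.+1%:R.
have n0 : 0 < N%:R :> R by rewrite ltr0n.
have n1 : N.+1%:R = N%:R + 1 :> R by rewrite natr1.
have r0 : 0 < r by rewrite divr_gt0// ltr0n.
have rE : N.+1%:R * r = N%:R by rewrite /r mulrC divfK// pnatr_eq0.
elim: K => [|K ih]; first by rewrite big_nil leq0n mulr_ge0// exprn_ge0// ltW.
rewrite big_nat_recr//=; have [Kh|hK] := leqP K.+1 h.
  rewrite (ltnW Kh) in ih.
  have -> : window K = r ^+ (h - K) by rewrite /window (eqP (_ : K - h == 0)%N) ?add0n// subn_eq0 ltnW.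
  have e : (h - K = (h - K.+1).+1)%N by rewrite -subSn// subSS.
  rewrite e in ih *; move: ih; rewrite exprS mulrA rE; set y := r ^+ _ => ih.
  have y0 : 0 < y by rewrite exprn_gt0.
  have r1 : r <= 1 by rewrite /r ler_pdivrMr ?ltr0n// mul1r ler_nat.
  by rewrite n1; nra.
rewrite ltnS in hK; rewrite subSn// exprS.
have -> : window K = r ^+ (K - h).
  by rewrite /window (eqP (_ : h - K == 0)%N) ?addn0// subn_eq0.
rewrite mulrA rE; move: ih; set y := r ^+ (K - h) => ih.
have {}ih : \sum_(0 <= k < K) window k <= 2 * N.+1%:R - N.+1%:R * y.
  apply: (le_trans ih); case: ifP => // Kh.
  have e : K = h by apply/eqP; rewrite eqn_leq Kh hK.
  by rewrite /y e subnn expr0; lra.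
by apply: (le_trans (lerD ih (lexx y))); rewrite n1; lra.
Qed.

Lemma window_sum : (0 < N)%N ->
  (\esum_(b in [set: seq bool]) (2^-1 ^+ size b * window (size b))%:E <= (2 * N.+1%:R)%:E)%E.
Proof.
move=> N0; rewrite (esum_seq_bool (f := fun k => 2^-1 ^+ k * window k)); last first.
  by move=> k; rewrite mulr_ge0 ?exprn_ge0// ltW// window_gt0.
under eq_esum do rewrite mulrA -exprMn mulfV// expr1n mul1r.
rewrite -nneseries_esumT; last by move=> k; rewrite lee_fin ltW// window_gt0.
apply: lime_le; first by apply: is_cvg_nneseries => k _ _; rewrite lee_fin ltW// window_gt0.
apply: nearW => K; rewrite sumEFin lee_fin (le_trans (window_partial_sum K N0))//.
have r0 : 0 <= (N%:R / N.+1%:R : R) by rewrite divr_ge0.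
have r1 : (N%:R / N.+1%:R : R) <= 1 by rewrite ler_pdivrMr ?ltr0n// mul1r ler_nat.
case: ifP => _.
  rewrite mulrC ler_wpM2r//; apply: (@le_trans _ _ 1); last by rewrite ler1n.
  by rewrite exprn_ile1.
by rewrite gerBl mulr_ge0// exprn_ge0.
Qed.

End string_sums.

(** * Gibbs inequality and weak duality *)

Section converse.
Context {R : realType} {I : countType}.
Variables (P : I -> R) (Z : I -> R) (H : R).
Hypotheses (P0 : forall x, 0 <= P x) (P1 : (\esum_(x in [set: I]) (P x)%:E = 1)%E).
Hypothesis Z0 : forall x, 0 <= Z x.
Hypothesis ZP : forall x, 0 < P x -> Z x = - ln (P x) / ln 2.
Hypothesis EZ : Ex P Z = H%:E.
Variables (e : I -> seq bool -> R) (D : seq bool -> I -> R).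
Hypotheses (e0 : forall x b, 0 <= e x b)
  (e1 : forall x, (\esum_(b in [set: seq bool]) (e x b)%:E = 1)%E).
Hypotheses (D0 : forall b x, 0 <= D b x)
  (D1 : forall b, (\esum_(x in [set: I]) (D b x)%:E = 1)%E).

Definition hit x : R := fine (\esum_(b in [set: seq bool]) (e x b * D b x)%:E)%E.

Let Dle1 b x : D b x <= 1.
Proof. by apply: pmf_le1 => //; rewrite D1. Qed.

Let ele1 x b : e x b <= 1.
Proof. by apply: pmf_le1 => //; rewrite e1. Qed.

Lemma hitE x : (\esum_(b in [set: seq bool]) (e x b * D b x)%:E = (hit x)%:E)%E.
Proof.
have le1 : (\esum_(b in [set: seq bool]) (e x b * D b x)%:E <= 1)%E.
  by rewrite -(e1 x); apply: le_esum => b _; rewrite lee_fin ler_piMr.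
rewrite /hit fineK// ge0_fin_numE ?(le_lt_trans le1) ?ltry// esum_ge0// => b _.
by rewrite lee_fin mulr_ge0.
Qed.

Lemma hit_ge0 x : 0 <= hit x.
Proof. by rewrite fine_ge0// esum_ge0// => b _; rewrite lee_fin mulr_ge0. Qed.

Lemma missE x : (\esum_(b in [set: seq bool]) (e x b * (1 - D b x))%:E = (1 - hit x)%:E)%E.
Proof.
rewrite EFinB -hitE -(e1 x).
rewrite [X in (_ = X - _)%E](_ : _ = \esum_(b in [set: seq bool]) (e x b * D b x)%:E +
   \esum_(b in [set: seq bool]) (e x b * (1 - D b x))%:E)%E.
  by rewrite hitE addeAC subee// add0e.
rewrite -esumD; first by apply: eq_esum => b _; rewrite -EFinD; congr EFin; ring.
  by move=> b _; rewrite lee_fin mulr_ge0.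
by move=> b _; rewrite lee_fin mulr_ge0// subr_ge0.
Qed.

Lemma hit_le1 x : hit x <= 1.
Proof.
rewrite -subr_ge0 -lee_fin -missE esum_ge0// => b _.
by rewrite lee_fin mulr_ge0// subr_ge0.
Qed.

Lemma Ex_miss : (\esum_(x in [set: I]) \esum_(b in [set: seq bool])
   (P x * e x b * (1 - D b x))%:E = Ex P (fun x => 1 - hit x)%R)%E.
Proof.
apply: eq_esum => x _; rewrite EFinM -missE -esumZl//.
  by apply: eq_esum => b _; rewrite -EFinM mulrA.
by move=> b; rewrite lee_fin mulr_ge0// subr_ge0.
Qed.

Lemma ln2_ge_half : 2^-1 <= ln 2 :> R.
Proof.
have := @le_ln1Dx R (- 2^-1); have -> : 1 + - 2^-1 = 2^-1 :> R by field.
by rewrite lnV ?posrE// => /(_ _); rewrite lerN2; apply; lra.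
Qed.

Lemma entr_nonneg : 0 <= H.
Proof. by rewrite -lee_fin -EZ Ex_ge0. Qed.

Variable N : nat.
Hypothesis N4 : (4 <= N)%N.
Let h := Num.truncn H.
Let g : nat -> R := window N h.

Let N0 : 0 < N%:R :> R. Proof. by rewrite ltr0n (leq_trans _ N4). Qed.

(* Apply [ln y <= y] to [y = 2 ^- size b * g (size b) / (N * P x)]. *)
Lemma redundancy_pointwise x (b : seq bool) : 0 < P x ->
  Z x - (size b)%:R <= 4 * ln N%:R + 1 + 4 / N%:R * `|Z x - H|
    + 4 / N%:R * (2^-1 ^+ size b * g (size b) / P x).
Proof.
move=> px; set l := size b.
have g0 : 0 < g l by apply: window_gt0; rewrite (leq_trans _ N4).
have l0 : 0 < 2^-1 ^+ l :> R by rewrite exprn_gt0.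
set G := 2^-1 ^+ l * g l / P x; have G0 : 0 < G by rewrite !mulr_gt0// invr_gt0.
have N1 : 1 <= N%:R :> R by rewrite ler1n (leq_trans _ N4).
have N4' : 4 <= N%:R :> R by rewrite ler_nat.
have lnN0 : 0 <= ln N%:R :> R by rewrite ln_ge0.
have i0 : 0 < N%:R^-1 :> R by rewrite invr_gt0.
have i4 : N%:R^-1 <= 4^-1 :> R by rewrite lef_pV2 ?posrE.
have hG : ln (G / N%:R) <= G / N%:R by rewrite ltW// ln_sublinear// divr_gt0.
have lnh : ln (2^-1 ^+ l) = - (l%:R * ln 2) :> R.
  by rewrite lnXn ?invr_gt0// lnV ?posrE// mulNrn mulr_natl.
have ln_g : - ((l - h + (h - l))%N%:R / N%:R) <= ln (g l).
  rewrite /g /window lnXn; last by rewrite divr_gt0// ltr0n.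
  rewrite -[leRHS]mulr_natl -[leLHS]mulrN ler_wpM2l//.
  have q0 : 0 < N.+1%:R / N%:R :> R by rewrite divr_gt0// ltr0n.
  rewrite -[N%:R / _]invf_div lnV; last by rewrite posrE.
  rewrite lerN2.
  have -> : N.+1%:R / N%:R = 1 + N%:R^-1 :> R by rewrite -natr1; field; rewrite gt_eqF.
  by apply: le_ln1Dx; lra.
have l2 := ln2_ge_half.
have lnP : ln (P x) = - (Z x * ln 2).
  by rewrite ZP// divfK ?opprK// gt_eqF// (lt_le_trans _ l2).
have lnG : ln (G / N%:R) = - (l%:R * ln 2) + ln (g l) + Z x * ln 2 - ln N%:R.
  rewrite ln_div ?posrE// /G ln_div ?posrE ?mulr_gt0// lnM ?posrE//.
  by rewrite lnP opprK lnh.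
rewrite lnG in hG.
have dist : (l - h + (h - l))%N%:R <= `|Z x - l%:R| + `|Z x - H| + 1 :> R.
  have /andP[h1 h2] := truncn_itv entr_nonneg; rewrite -/h in h1 h2.
  rewrite -natr1 in h2.
  have : `|l%:R - H| <= `|Z x - l%:R| + `|Z x - H|.
    by rewrite (distrC (Z x)) -[leLHS]/(`|l%:R - H|) (le_trans _ (ler_normD _ _))// addrA subrK.
  suff : (l - h + (h - l))%N%:R <= `|l%:R - H| + 1 :> R by lra.
  have [lh|hl] := leqP l h.
    have -> : (l - h = 0)%N by apply/eqP; rewrite subn_eq0.
    by rewrite add0n natrB//; have := ler_norm (H - l%:R); rewrite distrC; lra.
  have -> : (h - l = 0)%N by apply/eqP; rewrite subn_eq0 ltnW.
  by rewrite addn0 natrB ?(ltnW hl)//; have := ler_norm (l%:R - H); lra.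
have [u0|u0] := leP (Z x - l%:R) 0.
  apply: (le_trans u0); rewrite !addr_ge0 ?mulr_ge0 ?invr_ge0 ?(ltW N0)//; exact: ltW.
rewrite (gtr0_norm u0) in dist.
have {dist} dist : (l - h + (h - l))%N%:R / N%:R <= (Z x - l%:R + `|Z x - H| + 1) * N%:R^-1.
  by rewrite ler_wpM2r// ltW.
have q0 := normr_ge0 (Z x - H).
(* The difference Z - l occurs on both sides, since the distance from l to H is bounded through Z.
   Its coefficient is at least 1/2 from ln 2 and loses 1 / N <= 1/4; the remaining 1/4 explains the
   factors 4. *)
have key : (Z x - l%:R) * ln 2 - (Z x - l%:R + `|Z x - H| + 1) * N%:R^-1 - ln N%:R <= G * N%:R^-1.
  by move: hG ln_g; lra.
have : (Z x - l%:R) * 2^-1 <= (Z x - l%:R) * ln 2 by rewrite ler_wpM2l// ltW.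
have : (Z x - l%:R) * N%:R^-1 <= (Z x - l%:R) * 4^-1 by rewrite ler_wpM2l// ltW.
by move: key i4; lra.
Qed.

(** [redundancy_pointwise] is averaged over correct decoding. In the Gibbs term P x cancels and the
    decoder sums to 1 over x, leaving 4 / N times the mass 2 (N + 1) of the strings, at most 10;
    hence 11 = 1 + 10. *)
Lemma Ex_hit_info (A : R) : (Ex P (fun x => `|Z x - H|)%R <= A%:E)%E ->
  (Ex P (fun x => hit x * Z x)%R <=
   \esum_(x in [set: I]) \esum_(b in [set: seq bool]) (P x * e x b * (size b)%:R)%:E
   + (4 * ln N%:R + 11 + 4 / N%:R * A)%:E)%E.
Proof.
move=> hA.
have N1 : 1 <= N%:R :> R by rewrite ler1n (leq_trans _ N4).
have lnN0 : 0 <= ln N%:R :> R by rewrite ln_ge0.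
have i0 : 0 <= 4 / N%:R :> R by rewrite divr_ge0// ltW.
pose K : R := 4 * ln N%:R + 1; have K0 : 0 <= K by rewrite addr_ge0// mulr_ge0.
have Nb : (0 < N)%N by rewrite (leq_trans _ N4).
pose w (b : seq bool) : R := 2^-1 ^+ size b * g (size b).
have w0 b : 0 <= w b by rewrite mulr_ge0 ?exprn_ge0// ltW// window_gt0.
pose a1 x (b : seq bool) : R := P x * e x b * (size b)%:R.
pose a2 x (b : seq bool) : R := P x * (K + 4 / N%:R * `|Z x - H|) * e x b.
pose a3 x (b : seq bool) : R := 4 / N%:R * (w b * D b x).
have a10 x b : (0 <= (a1 x b)%:E)%E by rewrite lee_fin !mulr_ge0.
have k0 x : 0 <= K + 4 / N%:R * `|Z x - H| by rewrite addr_ge0// mulr_ge0.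
have a20 x b : (0 <= (a2 x b)%:E)%E by rewrite lee_fin mulr_ge0// mulr_ge0.
have a30 x b : (0 <= (a3 x b)%:E)%E by rewrite lee_fin mulr_ge0// mulr_ge0.
apply: (@le_trans _ _ (\esum_(x in [set: I]) \esum_(b in [set: seq bool])
    ((a1 x b)%:E + ((a2 x b)%:E + (a3 x b)%:E)))%E).
  apply: le_esum => x _.
  have -> : ((P x * (hit x * Z x))%:E =
      \esum_(b in [set: seq bool]) ((P x * Z x)%:E * (e x b * D b x)%:E))%E.
    rewrite esumZl ?mulr_ge0//; last by move=> b; rewrite lee_fin mulr_ge0.
    by rewrite hitE -EFinM; congr EFin; ring.
  apply: le_esum => b _; rewrite -EFinM -!EFinD lee_fin.
  have := P0 x; rewrite le_eqVlt => /predU1P[px|px].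
    by rewrite -px !mul0r -lee_fin !EFinD !adde_ge0.
  have := redundancy_pointwise b px; rewrite -/(w b) -/K => hu.
  have E1 : P x * Z x * (e x b * D b x) <= P x * e x b * (size b)%:R * D b x +
      P x * e x b * D b x * (K + 4 / N%:R * `|Z x - H| + 4 / N%:R * (w b / P x)).
    have c0 : 0 <= P x * (e x b * D b x) by rewrite !mulr_ge0.
    have := ler_wpM2l c0 hu; lra.
  (* The factor D <= 1 is dropped from the length and deviation terms. The Gibbs term drops e <= 1
     instead and keeps D, whose sum over x is 1. *)
  apply: (le_trans E1); apply: lerD.
    by rewrite ler_piMr// !mulr_ge0.
  rewrite mulrDr; apply: lerD.
    have -> : P x * e x b * D b x * (K + 4 / N%:R * `|Z x - H|) = a2 x b * D b x.
      by rewrite /a2; ring.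
    by rewrite ler_piMr// -lee_fin a20.
  have -> : P x * e x b * D b x * (4 / N%:R * (w b / P x)) = 4 / N%:R * (w b * D b x) * e x b.
    by field; rewrite !gt_eqF.
  by rewrite ler_piMr// -lee_fin a30.
under eq_esum => x _.
  rewrite esumD; [|by move=> b _; exact: a10|by move=> b _; rewrite adde_ge0].
  over.
rewrite esumD; last 2 first.
- by move=> x _; apply: esum_ge0 => b _; exact: a10.
- by move=> x _; apply: esum_ge0 => b _; rewrite adde_ge0.
apply: leeD2l.
under eq_esum => x _.
  rewrite esumD; [|by move=> b _; exact: a20|by move=> b _; exact: a30].
  over.
rewrite esumD; last 2 first.
- by move=> x _; apply: esum_ge0 => b _; exact: a20.
- by move=> x _; apply: esum_ge0 => b _; exact: a30.
have -> : 4 * ln N%:R + 11 + 4 / N%:R * A = (K + 4 / N%:R * A) + 10 by rewrite /K; ring.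
rewrite EFinD; apply: leeD.
  apply: (@le_trans _ _ (Ex P (fun x => cst K x + 4 / N%:R * `|Z x - H|)%R)).
    apply: le_esum => x _; rewrite /a2.
    under eq_esum do rewrite EFinM.
    by rewrite esumZl ?e1 ?mule1 ?mulr_ge0// => b; rewrite lee_fin.
  rewrite ExD//.
  by rewrite Ex_cst// ExZ// [leRHS]EFinD leeD2l// [leRHS]EFinM lee_wpmul2l// lee_fin.
rewrite esum_swap//.
apply: (@le_trans _ _ (\esum_(b in [set: seq bool]) ((4 / N%:R)%:E * (w b)%:E))%E).
  apply: le_esum => b _; rewrite /a3.
  under eq_esum do rewrite mulrA EFinM.
  rewrite esumZl; [by rewrite D1 mule1 -EFinM|exact: mulr_ge0|by move=> x; rewrite lee_fin].
rewrite esumZl//.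
apply: (@le_trans _ _ ((4 / N%:R)%:E * (2 * N.+1%:R)%:E)%E).
  by apply: lee_wpmul2l; [rewrite lee_fin|exact: window_sum].
rewrite -EFinM lee_fin -[N.+1%:R]natr1.
have -> : 4 / N%:R * (2 * (N%:R + 1)) = 8 + 8 / N%:R :> R by field; rewrite gt_eqF.
have : 8 / N%:R <= 2 :> R by rewrite ler_pdivrMr// -natrM ler_nat (leq_trans (_ : 8 <= 2 * 4)%N)// leq_mul2l.
lra.
Qed.

Definition mean_excess (s : R) : \bar R := Ex P (fun x => Num.max 0 (s + (Z x - H)))%R.

(** Mean-zero deviations satisfy |u| = 2 u^+ - u; Z is added to both sides to keep the terms
    nonnegative. *)
Lemma Ex_abs_dev : (Ex P (fun x => `|Z x - H|)%R <= 2%:E * mean_excess 0)%E.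
Proof.
have m0 x : 0 <= Num.max 0 (0 + (Z x - H)) by rewrite le_max lexx.
have H0 := entr_nonneg.
have : (Ex P (fun x => `|Z x - H| + Z x)%R <= Ex P (fun x => 2 * Num.max 0 (0 + (Z x - H)) + cst H x)%R)%E.
  apply: Ex_le => // x _ /=; rewrite add0r.
  by have [u0|u0] := leP 0 (Z x - H); [rewrite ger0_norm//|rewrite ltr0_norm//]; lra.
rewrite (ExD P (fun x => `|Z x - H|))// (ExD P (fun x => 2 * Num.max 0 (0 + (Z x - H))))//; last first.
  by move=> x; rewrite mulr_ge0.
by rewrite ExZ// EZ Ex_cst// leeD2rE.
Qed.

Variable eps : R.
Hypothesis err_eps : (\esum_(x in [set: I]) \esum_(b in [set: seq bool])
   (P x * e x b * (1 - D b x))%:E <= eps%:E)%E.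

Let miss0 x : 0 <= 1 - hit x. Proof. by rewrite subr_ge0 hit_le1. Qed.

Let EZ_split : (Ex P (fun x => hit x * Z x)%R + Ex P (fun x => (1 - hit x) * Z x)%R = H%:E)%E.
Proof.
rewrite -ExD//; first by rewrite -EZ; apply: eq_Ex => x _; ring.
  by move=> x; rewrite mulr_ge0// hit_ge0.
by move=> x; rewrite mulr_ge0.
Qed.

(** Pointwise, (1 - hit) Z <= (1 - hit) (H - s) + (s + Z - H)^+. The multiplier H - s must be
    nonnegative for the error bound on 1 - [hit] to be usable. *)
Lemma weak_duality s : s <= H ->
  (H%:E <= Ex P (fun x => hit x * Z x)%R + ((eps * (H - s))%:E + mean_excess s))%E.
Proof.
move=> sH; rewrite -EZ_split leeD2l//.
have Hs : 0 <= H - s by rewrite subr_ge0.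
apply: (@le_trans _ _ (Ex P (fun x => (H - s) * (1 - hit x) + Num.max 0 (s + (Z x - H))))%R).
  apply: Ex_le => // x _; have := miss0 x; have := hit_ge0 x.
  by have [u0|u0] := leP 0 (s + (Z x - H)); nra.
rewrite ExD//; last 2 first.
- by move=> x; rewrite mulr_ge0.
- by move=> x; rewrite le_max lexx.
rewrite leeD2r// ExZ// mulrC EFinM lee_wpmul2l ?lee_fin//.
by rewrite -Ex_miss.
Qed.

Lemma mean_excess_ge s : 0 <= s -> (s%:E <= mean_excess s)%E.
Proof.
move=> s0; have H0 := entr_nonneg.
have : (Ex P (fun x => Z x + cst s x)%R <= Ex P (fun x => cst H x + Num.max 0 (s + (Z x - H)))%R)%E.
  by apply: Ex_le => // x _ /=; have [u0|u0] := leP 0 (s + (Z x - H)); lra.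
rewrite (ExD P Z)// (ExD P (cst H))//; last by move=> x; rewrite le_max lexx.
by rewrite EZ !Ex_cst// leeD2lE.
Qed.

Lemma Ex_hit_lossless : eps = 0 -> Ex P (fun x => hit x * Z x)%R = H%:E.
Proof.
move=> eps_0; rewrite -EZ; apply: eq_Ex => x px.
suff -> : hit x = 1 by rewrite mul1r.
apply/eqP; rewrite eq_le hit_le1/= -subr_le0.
have px0 : 0 < P x by rewrite lt_neqAle eq_sym px P0.
rewrite -(pmulr_rle0 _ px0) -lee_fin -eps_0 (le_trans _ err_eps)// Ex_miss.
rewrite /Ex (esumID [set x]); last by move=> y _; rewrite lee_fin mulr_ge0.
rewrite setTI esum_set1 ?lee_fin ?mulr_ge0// leeDl// esum_ge0// => y _.
by rewrite lee_fin mulr_ge0.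
Qed.

End converse.

(** * Bounds for a fixed side information sequence *)

Lemma ln_prod {R : realType} n (F : 'I_n -> R) : (forall i, 0 < F i) ->
  ln (\prod_(i < n) F i) = \sum_(i < n) ln (F i).
Proof.
elim: n F => [|n ih] F F0; first by rewrite !big_ord0 ln1.
by rewrite !big_ord_recl lnM ?posrE// ?ih// prodr_gt0.
Qed.

Lemma fG_bounds {R : realType} (eps : R) : 0 <= fG eps <= 1.
Proof.
rewrite /fG; case: ifP => _; last by rewrite lexx ler01.
by rewrite ltW ?gphi_gt0// gphi_le1.
Qed.

Section per_side_information.
Context {R : realType} {d : measure_display} {TY : measurableType d}.
Variable p : nat -> TY -> R.
Hypothesis hp : cond_pmf p.
Variables (c C : R).
Hypotheses (c0 : 0 < c) (C0 : 0 <= C).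

Definition info n (xs : n.-tuple nat) (ys : n.-tuple TY) : R :=
  \sum_(i < n) iota p (tnth xs i) (tnth ys i).

Definition entr_n n (ys : n.-tuple TY) : R := \sum_(i < n) entr p (tnth ys i).

Lemma info_ge0 n (xs : n.-tuple nat) ys : 0 <= info xs ys.
Proof. by apply: sumr_ge0 => i _; exact: iota_ge0. Qed.

Lemma info_devE n (xs : n.-tuple nat) ys : info_dev p xs ys = info xs ys - entr_n ys.
Proof. by rewrite /info_dev sumrB. Qed.

Lemma infoE n (xs : n.-tuple nat) ys : 0 < pn p xs ys -> info xs ys = - ln (pn p xs ys) / ln 2.
Proof.
move=> px; have pos i : 0 < p (tnth xs i) (tnth ys i).
  rewrite lt_neqAle eq_sym; case: hp => -> _ _; rewrite andbT.
  by apply/negP => /eqP e; move: px; rewrite /pn (bigD1 i)//= e mul0r ltxx.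
rewrite /pn ln_prod// -sumrN mulr_suml; apply: eq_bigr => i _.
by rewrite /Defs.iota /log2 div1r lnV ?posrE.
Qed.

Lemma info_cons n x y (xs : n.-tuple nat) ys :
  info (cons_tuple x xs) (cons_tuple y ys) = iota p x y + info xs ys.
Proof.
rewrite /info big_ord_recl !tnth0; congr (_ + _).
by apply: eq_bigr => i _; rewrite !tnthS.
Qed.

Lemma Ex_info n (ys : n.-tuple TY) : (forall i, regular p c C (tnth ys i)) ->
  Ex (fun xs => pn p xs ys) (fun xs => info xs ys) = (entr_n ys)%:E.
Proof.
have i0 := iota_ge0 hp; have [p0 p1 _] := hp.
elim: n ys => [|n ih] ys g.
  rewrite Ex_pn0//; last by move=> t; exact: info_ge0.
  by rewrite /info /entr_n !big_ord0.
move: g; rewrite (cons_tuple_eta ys); move: (thead ys) [tuple of behead ys] => y {}ys g.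
have gy : regular p c C y by have := g ord0; rewrite tnth0.
have gys i : regular p c C (tnth ys i) by have := g (lift ord0 i); rewrite tnthS.
have s0 : 0 <= entr_n ys by apply: sumr_ge0 => i _; exact: entr_ge0.
rewrite Ex_pnS//; last by move=> t; exact: info_ge0.
have -> : entr_n (cons_tuple y ys) = entr p y + entr_n ys.
  rewrite /entr_n big_ord_recl tnth0; congr (_ + _).
  by apply: eq_bigr => i _; rewrite tnthS.
rewrite EFinD -(regularH hp gy) condHE -(Ex_cst (p ^~ y) _ (p0 ^~ y) (p1 y) s0) -ExD//.
apply: eq_esum => x _; rewrite EFinM; congr (_ * _)%E.
rewrite EFinD -ih// -(Ex_cst _ _ (fun xs => pn_ge0 hp xs ys) (pn_sum1 hp ys) (i0 x y)) -ExD//.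
- by apply: eq_Ex => xs _; rewrite info_cons.
- by move=> xs; exact: pn_ge0.
- by move=> xs; exact: i0.
- by move=> xs; exact: info_ge0.
Qed.

Lemma excessE n (ys : n.-tuple TY) s : excess p ys s =
  mean_excess (fun xs => pn p xs ys) (fun xs => info xs ys) (entr_n ys) s.
Proof. by apply: eq_Ex => xs _; rewrite info_devE. Qed.

(** A crude linear bound, r <= r^2; it is used only in a term divided by n. *)
Lemma sdev_le n (ys : n.-tuple TY) : (forall i, regular p c C (tnth ys i)) ->
  sdev p ys <= 1 + n%:R * (1 + C).
Proof.
move=> g; have r1 := sdev_ge1 hp c0 g.
have : sdev p ys ^+ 2 <= 1 + n%:R * (1 + C).
  rewrite (sdev_sq hp c0 g) lerD2l mulr_natl -[in leRHS](card_ord n) -sumr_const.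
  by apply: ler_sum => i _; have /andP[] := vari_bounds hp c0 (g i).
nra.
Qed.

Local Notation err n := (lindeberg_err c C n).

(** The bracket 2 (1 + n (1 + C) + err) bounds E |Z - H|, by [Ex_abs_dev] and U(r, 0) <= r. Taking N
    = n in the window turns it into O(1). *)
Definition converse_err n : R :=
  err n + (4 * ln n%:R + 11 + 4 / n%:R * (2 * (1 + n%:R * (1 + C) + err n))).

Lemma converse_pointwise n (eps : R) (ys : n.-tuple TY)
    (enc : n.-tuple nat -> n.-tuple TY -> seq bool -> R)
    (dec : seq bool -> n.-tuple TY -> n.-tuple nat -> R) :
  (4 <= n)%N -> 0 <= eps <= 1 -> (forall i, regular p c C (tnth ys i)) -> is_code enc dec ->
  (cond_err p enc dec ys <= eps%:E)%E ->
  (((1 - eps) * entr_n ys)%:E <=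
   \esum_(xs in [set: n.-tuple nat]) \esum_(b in [set: seq bool])
      (pn p xs ys * enc xs ys b * (size b)%:R)%:E + (fG eps * sdev p ys + converse_err n)%:E)%E.
Proof.
move=> n4 /andP[eps0 eps1] g [[e0 e1 _] [D0 D1 _]] herr.
have P0 xs : 0 <= pn p xs ys by exact: pn_ge0.
have P1 := pn_sum1 hp ys.
have Z0 xs : 0 <= info xs ys by exact: info_ge0.
have ZP xs : 0 < pn p xs ys -> info xs ys = - ln (pn p xs ys) / ln 2 by exact: infoE.
have EZ := Ex_info g.
set P := fun xs => pn p xs ys in P1 EZ; set Z := fun xs => info xs ys in EZ.
set H := entr_n ys in EZ *.
have H0 : 0 <= H by apply: sumr_ge0 => i _; exact: entr_ge0.
have e0' xs b : 0 <= enc xs ys b by [].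
have e1' xs := e1 xs ys.
have D0' b xs : 0 <= dec b ys xs by [].
have D1' b := D1 b ys.
set r := sdev p ys.
have r1 : 1 <= r := sdev_ge1 hp c0 g.
have r0 : 0 < r by apply: lt_le_trans r1.
have rle : r <= 1 + n%:R * (1 + C) := sdev_le g.
have B0 := lindeberg_err_ge0 c0 C0 n.
have approx s : (mean_excess P Z H s <= (gU r s + err n)%:E)%E.
  by rewrite -excessE; have [] := normal_approx hp c0 C0 s g.
set LEN := (\esum_(xs in _) _)%E.
have LEN0 : (0 <= LEN)%E.
  apply: esum_ge0 => xs _; apply: esum_ge0 => b _; rewrite lee_fin mulr_ge0// mulr_ge0//.
have Aerr : (Ex P (fun xs => `|Z xs - H|)%R <= (2 * (1 + n%:R * (1 + C) + err n))%:E)%E.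
  apply: (le_trans (Ex_abs_dev P0 P1 Z0 EZ)).
  rewrite EFinM lee_wpmul2l ?lee_fin// (le_trans (approx 0))// lee_fin lerD2r.
  rewrite /gU mul0r add0r (le_trans _ rle)// ler_piMr ?(ltW r0)//; exact: gphi_le1.
have hitL := Ex_hit_info P0 P1 Z0 ZP EZ e0' e1' D0' D1' n4 Aerr.
rewrite -/LEN in hitL.
set Q := Ex P _ in hitL.
have /andP[f0 f1] := fG_bounds eps.
have n0 : 0 < n%:R :> R by rewrite ltr0n (leq_trans _ n4).
have lnn0 : 0 <= ln n%:R :> R by rewrite ln_ge0// ler1n (leq_trans _ n4).
have rest0 : 0 <= 4 * ln n%:R + 11 + 4 / n%:R * (2 * (1 + n%:R * (1 + C) + err n)).
  have q0 : 0 <= 4 / n%:R :> R by rewrite divr_ge0// ltW.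
  have q1 : 0 <= n%:R * (1 + C) by rewrite mulr_ge0 ?addr_ge0// ltW.
  have : 0 <= 4 / n%:R * (2 * (1 + n%:R * (1 + C) + err n)).
    by rewrite mulr_ge0// mulr_ge0//; lra.
  lra.
(* The second alternative is the degenerate case where the main term is already nonpositive up to
   the error, so that nonnegativity of the length is enough. *)
suff main : (((1 - eps) * H)%:E <= Q + (fG eps * r + err n)%:E)%E \/
            (1 - eps) * H <= fG eps * r + err n.
  case: main => main.
    apply: (le_trans main); apply: (le_trans (leeD2r _ hitL)).
    by rewrite -addeA -EFinD leeD2l// lee_fin /converse_err; lra.
  apply: (@le_trans _ _ (0 + (fG eps * r + converse_err n)%:E)%E); last exact: leeD2r.
  by rewrite add0e lee_fin (le_trans main)// /converse_err; lra.
move: (eps0); rewrite le_eqVlt => /predU1P[eps_0|eps_gt0].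
  left; have -> : (1 - eps) * H = H by rewrite -eps_0 subr0 mul1r.
  rewrite /Q.
  rewrite (Ex_hit_lossless P0 EZ e0' e1' D0' D1' herr (esym eps_0)).
  by rewrite leeDl// lee_fin addr_ge0// mulr_ge0// ltW.
move: (eps1); rewrite le_eqVlt => /predU1P[eps_1|eps_lt1].
  right; have -> : (1 - eps) * H = 0 by rewrite eps_1 subrr mul0r.
  by rewrite addr_ge0// mulr_ge0// ltW.
have eps01 : 0 < eps < 1 by rewrite eps_gt0.
have wE := gPhi_invK eps eps01.
have fE : fG eps = gphi (gPhi_inv eps) by rewrite /fG eps01.
(* s = r w is the point where the tangent to U has slope eps, the maximizer of eps s - U(r, s). *)
set w := gPhi_inv eps in wE fE; set s := r * w.
have UE : gU r s = eps * s + fG eps * r.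
  by rewrite /s gU_tangent_eq// wE fE; ring.
have ap := approx s; rewrite UE in ap.
have [sH|Hs] := leP s H.
  left; have := weak_duality P0 Z0 EZ e0' e1' D0' D1' herr sH.
  rewrite -/Q => h.
  have {}h : (H%:E <= Q + (eps * H + fG eps * r + err n)%:E)%E.
    apply: (le_trans h); rewrite leeD2l//.
    apply: (@le_trans _ _ ((eps * (H - s))%:E + (eps * s + fG eps * r + err n)%:E)%E).
      exact: leeD2l.
    by rewrite -EFinD lee_fin; lra.
  have -> : (1 - eps) * H = H - eps * H by ring.
  rewrite EFinB leeBlDr// -addeA -EFinD (le_trans h)// leeD2l// lee_fin; lra.
right; have s0 : 0 <= s by rewrite (le_trans H0)// ltW.
have := le_trans (mean_excess_ge P0 P1 Z0 EZ s0) ap; rewrite lee_fin.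
have : (1 - eps) * H <= (1 - eps) * s by rewrite ler_wpM2l ?subr_ge0// ltW.
lra.
Qed.

(** The 2 collects one bit for rounding the information up to a shell index and one bit for the
    cutoff shell. *)
Lemma achievability_pointwise n (eps : R) (ys : n.-tuple TY) :
  0 <= eps <= 1 -> (forall i, regular p c C (tnth ys i)) ->
  (\esum_(xs in [set: n.-tuple nat]) \esum_(b in [set: seq bool])
      (pn p xs ys * shell_enc (1 - eps) (fun xs => pn p xs ys) xs b * (size b)%:R)%:E
   + (fG eps * sdev p ys)%:E <= ((1 - eps) * entr_n ys)%:E + (err n + 2)%:E)%E.
Proof.
move=> /andP[eps0 eps1] g.
have a0 : 0 <= 1 - eps by rewrite subr_ge0.
have a1 : 1 - eps <= 1 by rewrite lerBlDr lerDl.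
have P0 xs : 0 <= pn p xs ys by exact: pn_ge0.
have P1 := pn_sum1 hp ys.
have Z0 xs : 0 <= info xs ys by exact: info_ge0.
have ZP xs : 0 < pn p xs ys -> info xs ys = - ln (pn p xs ys) / ln 2 by exact: infoE.
have EZ := Ex_info g.
set P := fun xs => pn p xs ys in P1 EZ *; set Z := fun xs => info xs ys in EZ.
set H := entr_n ys in EZ *.
set r := sdev p ys.
have r0 : 0 < r by apply: lt_le_trans (sdev_ge1 hp c0 g).
have B0 := lindeberg_err_ge0 c0 C0 n.
have approx s : ((gU r s)%:E <= mean_excess P Z H s + (err n)%:E)%E.
  by rewrite -excessE; have [] := normal_approx hp c0 C0 s g.
have len := shell_code_len P0 P1 (1 - eps) Z0 ZP.
apply: (le_trans (leeD2r _ len)).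
have kb xs := kept_bounds P0 P1 (1 - eps) xs.
move: (eps0); rewrite le_eqVlt => /predU1P[eps_0|eps_gt0].
  rewrite /fG -eps_0 ltxx/= mul0r adde0 subr0 mul1r -EZ.
  apply: leeD; last by rewrite lee_fin; lra.
  apply: Ex_le => // xs _; rewrite ler_piMl//.
  by have /andP[] := kb xs; rewrite -eps_0 subr0.
have alt : 1 - eps < 1 by rewrite ltrBlDr ltrDl.
have [t ht] := kept_info_cutoff P0 P1 a0 a1 Z0 ZP EZ alt.
rewrite subKr in ht; pose s := H - t.
have FE : Ex P (fun x => Num.max 0 (Z x - t))%R = mean_excess P Z H s.
  by apply: eq_Ex => xs _; rewrite /s; congr Num.max; ring.
rewrite FE in ht.
have low : ((eps * s + fG eps * r)%:E <= mean_excess P Z H s + (err n)%:E)%E.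
  move: (eps1); rewrite le_eqVlt => /predU1P[eps_1|eps_lt1].
    rewrite eps_1 mul1r /fG ltxx andbF mul0r addr0.
    apply: (@le_trans _ _ (mean_excess P Z H s)); last by rewrite leeDl.
    have [s0|s0] := leP 0 s; first exact: mean_excess_ge.
    apply: (@le_trans _ _ 0%E); first by rewrite lee_fin ltW.
    by apply: Ex_ge0 => // xs; rewrite le_max lexx.
  have eps01 : 0 < eps < 1 by rewrite eps_gt0.
  have wE := gPhi_invK eps eps01.
  apply: le_trans (approx s); rewrite lee_fin /fG eps01 -[X in X * s]wE mulrC (mulrC _ r).
  by rewrite (mulrC s); exact: gU_tangent.
set K := Ex P _ in ht *.
have K0 : (0 <= K)%E.
  by apply: Ex_ge0 => // xs; rewrite mulr_ge0//; have /andP[] := kb xs.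
(* Finiteness of the kept information allows the rest to be linear arithmetic over the reals. *)
have Kfin : K \is a fin_num.
  rewrite ge0_fin_numE//; have F0 : (0 <= mean_excess P Z H s)%E.
    by apply: Ex_ge0 => // xs; rewrite le_max lexx.
  have : (K + ((eps * t)%:E) <= (H + 1)%:E)%E.
    by apply: le_trans ht; rewrite leeD2l// leeDr.
  by rewrite -leeBrDr// -EFinB => /le_lt_trans; apply; rewrite ltry.
move: ht low; rewrite -(fineK Kfin); move: (fine K) => k.
rewrite -!EFinD.
by case: (mean_excess P Z H s) => [f ht low||]//; move: ht low; rewrite -!EFinD !lee_fin /s; lra.
Qed.

End per_side_information.

(** * Integration over the side information *)

Section log_sums.
Context {R : realType}.

Lemma ln2_le1 : ln 2 <= 1 :> R.
Proof. by rewrite -[2]/(1 + 1) le_ln1Dx// (lt_trans _ ltr01)// ltrN10. Qed.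

Lemma ln_ge_half n : (2 <= n)%N -> 2^-1 <= ln n%:R :> R.
Proof.
move=> n2; apply: (le_trans (@ln2_ge_half R)).
by rewrite ler_ln ?posrE ?ltr0n ?ler_nat// (leq_trans _ n2).
Qed.

(** Each step uses 1 / (n + 1) <= 2 / (n + 2) <= 2 ln ((n + 2) / (n + 1)), the last from ln (1 - x)
    <= -x. *)
Lemma harmonic_bound n : \sum_(k < n) k.+1%:R^-1 <= 2 * ln n.+1%:R :> R.
Proof.
elim: n => [|n ih]; first by rewrite big_ord0 ln1 mulr0.
rewrite big_ord_recr/= (le_trans (lerD ih (lexx _)))//.
have n1 : 0 < n.+1%:R :> R by rewrite ltr0n.
have n2 : 0 < n.+2%:R :> R by rewrite ltr0n.
have e : n.+2%:R = n.+1%:R + 1 :> R by rewrite natr1.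
have := @le_ln1Dx R (- n.+2%:R^-1).
have -> : 1 + - n.+2%:R^-1 = n.+1%:R / n.+2%:R :> R.
  by rewrite e; move: n1; move: (n.+1%:R : R) => x x0; field; rewrite gt_eqF// addr_gt0.
rewrite ltrN2 invf_lt1// ltr1n => /(_ isT); rewrite ln_div ?posrE// => h.
have : n.+1%:R^-1 <= 2 * n.+2%:R^-1 :> R.
  rewrite -[leLHS]mul1r ler_pdivlMr// mulrAC ler_pdivrMr// mul1r e.
  have : 1 <= n.+1%:R :> R by rewrite ler1n.
  by move: (n.+1%:R : R) => x; lra.
move: h; move: (n.+1%:R^-1 : R) (n.+2%:R^-1 : R) (ln n.+1%:R : R) (ln n.+2%:R : R).
by move=> x y z t; lra.
Qed.

(** With b = min(1, a), 1 + a k >= b (k + 1); then ln (n + 1) <= 2 ln n, as n + 1 <= n^2 for n >=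
    2. *)
Lemma harmonic_like_bound (a D : R) : 0 < a -> 0 <= D ->
  exists2 K, 0 <= K & forall n, (2 <= n)%N -> \sum_(k < n) D / (1 + a * k%:R) <= K * ln n%:R.
Proof.
move=> a0 D0; pose b := Num.min 1 a; have b0 : 0 < b by rewrite lt_min ltr01.
exists (4 * D / b) => [|n n2]; first by rewrite divr_ge0 ?mulr_ge0// ltW.
apply: (@le_trans _ _ (\sum_(k < n) D / b * k.+1%:R^-1)).
  apply: ler_sum => k _; rewrite -mulrA -invfM ler_wpM2l//.
  have b1 : b <= 1 by rewrite ge_min lexx.
  have ba : b <= a by rewrite ge_min lexx orbT.
  rewrite lef_pV2 ?posrE ?mulr_gt0 ?ltr0n//; last by rewrite ltr_wpDr// mulr_ge0// ltW.
  rewrite -natr1 mulrDr mulr1 addrC lerD// ler_wpM2r//.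
rewrite -mulr_sumr; apply: (@le_trans _ _ (D / b * (2 * ln n.+1%:R))).
  by rewrite ler_wpM2l ?harmonic_bound// divr_ge0// ltW.
have -> : 4 * D / b * ln n%:R = D / b * (2 * (2 * ln n%:R)) by rewrite -!mulrA; ring.
rewrite ler_wpM2l ?divr_ge0 ?(ltW b0)// ler_wpM2l//.
rewrite mulr_natl -lnXn ?ltr0n ?(leq_trans _ n2)// ler_ln ?posrE ?ltr0n//.
  rewrite -natrX ler_nat -mulnn (@leq_trans (2 * n))//; last by rewrite leq_mul2r n2 orbT.
  by rewrite mul2n -addnn -addn1 leq_add2l (leq_trans _ n2).
by rewrite exprn_gt0// ltr0n (leq_trans _ n2).
Qed.

End log_sums.

(** * Measurability of the source quantities *)

Section source_measurability.
Context {R : realType} {d : measure_display} {TY : measurableType d}.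
Variable p : nat -> TY -> R.
Hypothesis hp : cond_pmf p.

Let p0 x y : 0 <= p x y. Proof. by case: hp. Qed.
Let mp x : measurable_fun [set: TY] (p x). Proof. by case: hp. Qed.

Lemma measurable_iota x : measurable_fun [set: TY] (iota p x).
Proof.
rewrite /Defs.iota /log2; apply: measurable_funM => //.
apply: (measurableT_comp (@measurable_ln R)); apply: measurable_funM => //.
exact: measurable_inv_ge0.
Qed.

Lemma measurable_condH : measurable_fun [set: TY] (condH p).
Proof.
apply: measurable_esum => [x y|x]; first by rewrite lee_fin mulr_ge0// iota_ge0.
apply/measurable_EFinP; apply: measurable_funM => //; exact: measurable_iota.
Qed.

Lemma ereal_sqr_ge0 (x : \bar R) : (0 <= x * x)%E.
Proof. by have [x0|/ltW x0] := leP 0%E x; [rewrite mule_ge0|rewrite mule_le0]. Qed.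

Lemma condV_ge0 y : (0 <= condV p y)%E.
Proof.
by apply: esum_ge0 => x _; rewrite mule_ge0 ?lee_fin// ereal_sqr_ge0.
Qed.

Lemma measurable_condV : measurable_fun [set: TY] (condV p).
Proof.
apply: measurable_esum => [x y|x].
  by rewrite mule_ge0 ?lee_fin// ereal_sqr_ge0.
have m1 : measurable_fun [set: TY] (fun y => (iota p x y)%:E - condH p y)%E.
  apply: emeasurable_funB; last exact: measurable_condH.
  by apply/measurable_EFinP; exact: measurable_iota.
apply: emeasurable_funM; first exact/measurable_EFinP.
exact: emeasurable_funM.
Qed.

Lemma measurable_vari : measurable_fun [set: TY] (vari p).
Proof. exact: (measurableT_comp (fine_measurable measurableT) measurable_condV). Qed.

Lemma measurable_pn n (xs : n.-tuple nat) : measurable_fun [set: n.-tuple TY] (pn p xs).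
Proof.
rewrite /pn; apply: measurable_prod => i _.
by apply: (measurableT_comp (mp _)); exact: measurable_tnth.
Qed.

Lemma vari_ge0 y : 0 <= vari p y.
Proof. by rewrite fine_ge0// condV_ge0. Qed.

End source_measurability.

(** * Both bounds averaged over the side information *)

Section integrated.
Context {R : realType} {d : measure_display} {TY : measurableType d}.
Variables (PY : probability TY R) (p : nat -> TY -> R).
Hypothesis hp : cond_pmf p.
Variables (c C : R).
Hypotheses (c0 : 0 < c) (C0 : 0 <= C).
Hypothesis reg : \forall y \ae PY, regular p c C y.

Local Notation m := (fine (Vc PY p)).

Let p0 x y : 0 <= p x y. Proof. by case: hp. Qed.

Lemma integral_vari : (\int[PY]_y (vari p y)%:E = m%:E)%E /\ c <= m <= 1 + C.
Proof.
have mv : measurable_fun [set: TY] (fun y => (vari p y)%:E).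
  by apply/measurable_EFinP; exact: measurable_vari.
have v0 := vari_ge0 hp.
have e : (\int[PY]_y (vari p y)%:E = Vc PY p)%E.
  apply/eqP; rewrite eq_le; apply/andP; split.
    apply: ae_ge0_le_integral => //.
    - by move=> y _; rewrite lee_fin.
    - by move=> y _; exact: condV_ge0.
    - exact: measurable_condV.
    - by apply: filterS reg => y gy _; rewrite (regularV hp c0 gy).
  apply: ae_ge0_le_integral => //.
  - by move=> y _; exact: condV_ge0.
  - exact: measurable_condV.
  - by move=> y _; rewrite lee_fin.
  - by apply: filterS reg => y gy _; rewrite (regularV hp c0 gy).
have lo : (c%:E <= Vc PY p)%E.
  rewrite -(integral_prob_cst PY c%:E) -e; apply: ae_ge0_le_integral => //.
  - by move=> y _; rewrite lee_fin ltW.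
  - by move=> y _; rewrite lee_fin.
  by apply: filterS reg => y gy _; rewrite lee_fin; have /andP[] := vari_bounds hp c0 gy.
have hi : (Vc PY p <= (1 + C)%:E)%E.
  rewrite -(integral_prob_cst PY (1 + C)%:E) -e; apply: ae_ge0_le_integral => //.
  - by move=> y _; rewrite lee_fin.
  - by move=> y _; rewrite lee_fin addr_ge0.
  by apply: filterS reg => y gy _; rewrite lee_fin; have /andP[] := vari_bounds hp c0 gy.
have f : Vc PY p \is a fin_num.
  rewrite ge0_fin_numE ?(le_lt_trans hi) ?ltry//.
  by rewrite (le_trans _ lo)// lee_fin ltW.
by rewrite e fineK// -!lee_fin fineK// lo hi.
Qed.

(** Stated with [condH], not with its finite part, so that an infinite [Hc] is covered. *)
Lemma iint_entr n (t : R) : 0 <= t ->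
  iint PY (fun ys : n.-tuple TY => t%:E * \sum_(i < n) condH p (tnth ys i))%E =
  ((n%:R * t)%:E * Hc PY p)%E.
Proof.
move=> t0; rewrite iintZl//.
- by rewrite iint_sum ?muleA -?EFinM 1?mulrC//; [exact: condH_ge0|exact: measurable_condH].
- by move=> ys; apply: sume_ge0 => i _; exact: condH_ge0.
- by apply: measurable_tuple_sum; exact: measurable_condH.
Qed.

Lemma measurable_sdev n : measurable_fun [set: n.-tuple TY] (fun ys => (sdev p ys)%:E).
Proof. by apply: measurable_sqrt_sum; exact: measurable_vari. Qed.

Lemma measurable_len n (enc : n.-tuple nat -> n.-tuple TY -> seq bool -> R) :
  (forall xs ys b, 0 <= enc xs ys b) ->
  (forall xs b, measurable_fun [set: n.-tuple TY] (fun ys => enc xs ys b)) ->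
  measurable_fun [set: n.-tuple TY] (fun ys =>
    \esum_(xs in [set: n.-tuple nat]) \esum_(b in [set: seq bool])
      (pn p xs ys * enc xs ys b * (size b)%:R)%:E)%E.
Proof.
move=> e0 me.
have t0 xs ys b : (0 <= (pn p xs ys * enc xs ys b * (size b)%:R)%:E)%E.
  by rewrite lee_fin !mulr_ge0// pn_ge0.
apply: measurable_esum => [xs ys|xs]; first by apply: esum_ge0.
apply: measurable_esum => [b ys //|b].
apply/measurable_EFinP; apply: measurable_funM => //; apply: measurable_funM => //.
exact: measurable_pn.
Qed.

Lemma sum_condH_regular n (ys : n.-tuple TY) : (forall i, regular p c C (tnth ys i)) ->
  (\sum_(i < n) condH p (tnth ys i) = (entr_n p ys)%:E)%E.
Proof.
by move=> g; rewrite /entr_n -sumEFin; apply: eq_bigr => i _; rewrite (regularH hp (g i)).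
Qed.

Lemma sum_condH_ge0 n (ys : n.-tuple TY) : (0 <= \sum_(i < n) condH p (tnth ys i))%E.
Proof. by apply: sume_ge0 => i _; exact: condH_ge0. Qed.

Let mV := measurable_vari hp.
Let m0 : 0 <= m. Proof. by have [_ /andP[h _]] := integral_vari; rewrite (le_trans _ h)// ltW. Qed.

Lemma converse_err_ge0 n : (4 <= n)%N -> 0 <= converse_err c C n.
Proof.
move=> n4; have B0 := lindeberg_err_ge0 c0 C0 n.
have n0 : 0 < n%:R :> R by rewrite ltr0n (leq_trans _ n4).
have lnn0 : 0 <= ln n%:R :> R by rewrite ln_ge0// ler1n (leq_trans _ n4).
have q0 : 0 <= 4 / n%:R :> R by rewrite divr_ge0// ltW.
have q1 : 0 <= n%:R * (1 + C) by rewrite mulr_ge0 ?addr_ge0// ltW.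
have : 0 <= 4 / n%:R * (2 * (1 + n%:R * (1 + C) + lindeberg_err c C n)).
  by rewrite mulr_ge0// mulr_ge0//; lra.
by rewrite /converse_err; lra.
Qed.

Lemma converse_integrated n (eps : R)
    (enc : n.-tuple nat -> n.-tuple TY -> seq bool -> R)
    (dec : seq bool -> n.-tuple TY -> n.-tuple nat -> R) : (4 <= n)%N -> 0 <= eps <= 1 ->
  is_code enc dec -> ae_n PY (fun ys => (cond_err p enc dec ys <= eps%:E)%E) ->
  ((n%:R * (1 - eps))%:E * Hc PY p <=
   exp_len PY p enc + (Num.sqrt (n%:R * m) * fG eps + (1 + converse_err c C n))%:E)%E.
Proof.
move=> n4 eps01 code [N [mN N0 errN]].
have /andP[f0 f1] := fG_bounds eps.
have E0 := converse_err_ge0 n4.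
have [[e0 e1 me] _] := code.
have a0 : 0 <= 1 - eps by move: eps01 => /andP[_ ?]; rewrite subr_ge0.
rewrite -iint_entr//.
set LEN := fun ys : n.-tuple TY => (\esum_(xs in [set: n.-tuple nat]) \esum_(b in [set: seq bool])
      (pn p xs ys * enc xs ys b * (size b)%:R)%:E)%E.
have LEN0 ys : (0 <= LEN ys)%E.
  by apply: esum_ge0 => xs _; apply: esum_ge0 => b _; rewrite lee_fin !mulr_ge0// pn_ge0.
have mLEN : measurable_fun [set: n.-tuple TY] LEN by exact: measurable_len.
have mS := @measurable_sdev n.
have mI : measurable_fun [set: n.-tuple TY] (fun ys => (\1_N ys)%:E : \bar R).
  by apply/measurable_EFinP; exact: measurable_indic.
have s0 (ys : n.-tuple TY) : (0 <= (sdev p ys)%:E)%E by rewrite lee_fin sqrtr_ge0.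
have i0 (ys : n.-tuple TY) : (0 <= (\1_N ys)%:E :> \bar R)%E by rewrite lee_fin.
pose T1 (ys : n.-tuple TY) := ((fG eps)%:E * (sdev p ys)%:E + (converse_err c C n)%:E)%E : \bar R.
have T10 (ys : n.-tuple TY) : (0 <= T1 ys)%E by apply: adde_ge0 => //; exact: mule_ge0.
have mT1 : measurable_fun [set: n.-tuple TY] T1.
  by apply: emeasurable_funD => //; apply: measurable_funeM.
(* The null set of the error constraint lives on whole tuples and is not described by exceptional
   letters, so [iint_le] cannot discard it. Adding +oo on it makes the comparison trivial there and
   does not change the integral. *)
pose T2 (ys : n.-tuple TY) := (+oo * (\1_N ys)%:E)%E : \bar R.
have T20 ys : (0 <= T2 ys)%E by rewrite /T2 mule_ge0.
have mT2 : measurable_fun [set: n.-tuple TY] T2 by apply: measurable_funeM.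
apply: (@le_trans _ _ (iint PY (fun ys => LEN ys + (T1 ys + T2 ys))%E)).
  apply: (@iint_le _ _ _ _ _ (regular p c C)) => //.
  - by move=> ys; rewrite mule_ge0 ?lee_fin// sum_condH_ge0.
  - by move=> ys; apply: adde_ge0 => //; exact: adde_ge0.
  - by apply: measurable_funeM; apply: measurable_tuple_sum; exact: measurable_condH.
  - by do 2 apply: emeasurable_funD => //.
  move=> ys g; rewrite sum_condH_regular//.
  have [yN|yN] := boolP (ys \in N).
    rewrite /T2 indicE yN mulr1n mule1 (_ : (LEN ys + _ = +oo)%E) ?leey//.
    by rewrite addeA addey// gt_eqF// (lt_le_trans (ltNyr 0))//; apply: adde_ge0.
  rewrite /T1 /T2 indicE (negPf yN) mule0 adde0 -!EFinM -EFinD.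
  apply: (converse_pointwise hp c0 C0 n4 eps01 g code).
  by apply: contrapT => /errN h; move: yN; rewrite notin_setE => /(_ h).
rewrite iintD//; last 2 first.
- by move=> ys; rewrite adde_ge0.
- exact: emeasurable_funD.
rewrite iintD// iintZl// N0 mule0 adde0 leeD2l//.
rewrite iintD//; last 2 first.
- by move=> ys; rewrite mule_ge0.
- by apply: measurable_funeM.
rewrite iint_cst iintZl//.
have [vm _] := integral_vari.
have := iint_sqrt_le mV (vari_ge0 hp) m0 vm n; rewrite -/(sdev p _) => hs.
apply: (@le_trans _ _ ((fG eps)%:E * (Num.sqrt (1 + n%:R * m))%:E + (converse_err c C n)%:E)%E).
  by rewrite leeD2r// lee_wpmul2l.
rewrite -EFinM -EFinD lee_fin; move: (converse_err c C n) => E.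
have nm0 : 0 <= n%:R * m by rewrite mulr_ge0.
have : Num.sqrt (1 + n%:R * m) <= Num.sqrt (n%:R * m) + 1.
  have h0 : 0 <= Num.sqrt (n%:R * m) + 1 by rewrite addr_ge0.
  rewrite -[leRHS]ger0_norm// -sqrtr_sqr ler_wsqrtr// sqrrD1 sqr_sqrtr//.
  by have := sqrtr_ge0 (n%:R * m); lra.
have := sqrtr_ge0 (n%:R * m); nra.
Qed.

Definition block_enc n (eps : R) (xs : n.-tuple nat) (ys : n.-tuple TY) (b : seq bool) : R :=
  shell_enc (1 - eps) (fun xs => pn p xs ys) xs b.

Definition block_dec n (b : seq bool) (ys : n.-tuple TY) (xs : n.-tuple nat) : R :=
  shell_dec (nseq_tuple n 0%N) (fun xs => pn p xs ys) b xs.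

Lemma block_code n (eps : R) : 0 <= eps <= 1 ->
  is_code (@block_enc n eps) (@block_dec n) /\
  forall ys, (cond_err p (@block_enc n eps) (@block_dec n) ys <= eps%:E)%E.
Proof.
move=> /andP[eps0 eps1].
have a0 : 0 <= 1 - eps by rewrite subr_ge0.
have a1 : 1 - eps <= 1 by rewrite lerBlDr lerDl.
have P0 (ys : n.-tuple TY) xs : 0 <= pn p xs ys by exact: pn_ge0.
have P1 (ys : n.-tuple TY) := pn_sum1 hp ys.
have mP (xs : n.-tuple nat) := measurable_pn hp xs.
split; last first.
  move=> ys; rewrite -[eps in leRHS](subKr 1).
  exact: (shell_code_err (P0 ys) (P1 ys) a0 a1).
split; split.
- by move=> xs ys b; apply: complete_ge0 => [c'|]; [exact: enc_sub_ge0|exact: enc_sub_sum_le1].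
- by move=> xs ys; apply: complete_sum1 => [c'|]; [exact: enc_sub_ge0|exact: enc_sub_sum_le1].
- by move=> xs b; apply: (measurable_shell_enc (P := fun xs ys => pn p xs ys)).
- move=> b ys xs; apply: (@complete_ge0 _ _ _ (fun x => (is_codeword (fun xs => pn p xs ys) x b)%:R)) => //.
  exact: dec_sub_sum_le1.
- move=> b ys; apply: (@complete_sum1 _ _ _ (fun x => (is_codeword (fun xs => pn p xs ys) x b)%:R)) => //.
  exact: dec_sub_sum_le1.
- by move=> b xs; apply: (measurable_shell_dec (P := fun xs ys => pn p xs ys)).
Qed.

Lemma achievability_integrated n (eps : R) : 0 <= eps <= 1 ->
  (exp_len PY p (@block_enc n eps) + (Num.sqrt (n%:R * m) * fG eps)%:E <=
   (n%:R * (1 - eps))%:E * Hc PY p +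
   (lindeberg_err c C n + 2 + sqrt_err m (1 + C) n)%:E)%E.
Proof.
move=> eps01; pose enc := @block_enc n eps.
have /andP[f0 f1] := fG_bounds eps.
have B0 := lindeberg_err_ge0 c0 C0 n.
have [[[e0 e1 me] _] _] := block_code n eps01.
have a0 : 0 <= 1 - eps by move: eps01 => /andP[_ ?]; rewrite subr_ge0.
rewrite -iint_entr//.
set LEN := fun ys : n.-tuple TY => (\esum_(xs in [set: n.-tuple nat]) \esum_(b in [set: seq bool])
      (pn p xs ys * enc xs ys b * (size b)%:R)%:E)%E.
have LEN0 ys : (0 <= LEN ys)%E.
  by apply: esum_ge0 => xs _; apply: esum_ge0 => b _; rewrite lee_fin !mulr_ge0// pn_ge0.
have mLEN : measurable_fun [set: n.-tuple TY] LEN by exact: measurable_len.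
have mS := @measurable_sdev n.
have s0 (ys : n.-tuple TY) : (0 <= (sdev p ys)%:E)%E by rewrite lee_fin sqrtr_ge0.
have [vm /andP[_ mM]] := integral_vari.
have mv1 : \forall y \ae PY, vari p y <= 1 + C.
  by apply: filterS reg => y gy; have /andP[] := vari_bounds hp c0 gy.
have hs := iint_sqrt_ge mV (vari_ge0 hp) m0 vm mv1 mM n (lexx 1).
set SQ := iint PY _ in hs.
have se0 : 0 <= sqrt_err m (1 + C) n.
  by apply: sumr_ge0 => k _; rewrite divr_ge0 ?sqr_ge0// addr_ge0// mulr_ge0.
have hs' : ((Num.sqrt (n%:R * m) * fG eps)%:E <= (fG eps)%:E * SQ + (sqrt_err m (1 + C) n)%:E)%E.
  apply: (@le_trans _ _ ((fG eps)%:E * (SQ + (sqrt_err m (1 + C) n)%:E))%E).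
    rewrite mulrC EFinM lee_wpmul2l ?lee_fin// (le_trans _ hs)// lee_fin ler_wsqrtr//.
    by rewrite lerDr.
  have SQ0 : (0 <= SQ)%E by apply: iint_ge0 => ys; exact: s0.
  rewrite ge0_muleDr//; apply: leeD2l; rewrite -EFinM lee_fin ler_piMl//.
apply: (le_trans (leeD2l _ hs')).
move: (sqrt_err m (1 + C) n) se0 {hs hs'} => se se0.
rewrite (EFinD _ se) [leLHS]addeA [leRHS]addeA; apply: leeD2r.
have -> : ((fG eps)%:E * SQ = iint PY (fun ys : n.-tuple TY => (fG eps)%:E * (sdev p ys)%:E))%E.
  by rewrite iintZl.
rewrite /exp_len -/LEN -iintD//; last 2 first.
- by move=> ys; rewrite mule_ge0.
- by apply: measurable_funeM.
rewrite -(iint_cst PY n (lindeberg_err c C n + 2)%:E) -iintD//; last 3 first.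
- by move=> ys; rewrite mule_ge0 ?lee_fin// sum_condH_ge0.
- by move=> ys; rewrite lee_fin addr_ge0.
- by apply: measurable_funeM; apply: measurable_tuple_sum; exact: measurable_condH.
apply: (@iint_le _ _ _ _ _ (regular p c C)) => //.
- by move=> ys; rewrite adde_ge0// mule_ge0.
- move=> ys; apply: adde_ge0; last by rewrite lee_fin addr_ge0.
  by rewrite mule_ge0 ?lee_fin// sum_condH_ge0.
- by apply: emeasurable_funD => //; apply: measurable_funeM.
- apply: emeasurable_funD => //.
  by apply: measurable_funeM; apply: measurable_tuple_sum; exact: measurable_condH.
move=> ys g; rewrite sum_condH_regular// -!EFinM.
exact: achievability_pointwise.
Qed.

End integrated.

Lemma error_terms_log {R : realType} (c C m : R) : 0 < c -> 0 <= C -> 0 < m ->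
  exists K : R, forall n, (4 <= n)%N ->
    lindeberg_err c C n + 2 + sqrt_err m (1 + C) n + 1 <= K * log2 (n%:R : R) /\
    1 + converse_err c C n <= K * log2 (n%:R : R).
Proof.
move=> c0 C0 m0.
have D0 : 0 <= C + (1 + C) ^+ 2 by rewrite addr_ge0// sqr_ge0.
have [K1 K10 h1] := harmonic_like_bound c0 D0.
have [K2 K20 h2] := harmonic_like_bound m0 (sqr_ge0 (1 + C)).
(* [converse_err] contains the exchange error once directly and 8 times through (1 + B) / n <= 1 +
   B; its constants, with the extra 1, add up to 28 + 8 C, doubled because 1 <= 2 ln n. *)
pose K := 9 * (2 + K1) + K2 + 4 + 2 * (28 + 8 * C).
exists K => n n4.
have n2 : (2 <= n)%N by rewrite (leq_trans _ n4).
have n0 : 0 < n%:R :> R by rewrite ltr0n (leq_trans _ n4).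
have n1 : 1 <= n%:R :> R by rewrite ler1n (leq_trans _ n4).
have l1 : 1 <= 2 * ln n%:R :> R by have := @ln_ge_half R n n2; lra.
have K0 : 0 <= K by rewrite /K; lra.
have logn : K * ln n%:R <= K * log2 (n%:R : R).
  rewrite ler_wpM2l// /log2 ler_pdivlMr ?ln2_gt0// ler_piMr ?ln2_le1//; lra.
have B0 := lindeberg_err_ge0 c0 C0 n.
have hB : lindeberg_err c C n <= (2 + K1) * ln n%:R.
  by rewrite /lindeberg_err mulrDl lerD// h1.
have hS : sqrt_err m (1 + C) n <= K2 * ln n%:R by exact: h2.
set B := lindeberg_err c C n in B0 hB *; set L := ln n%:R in l1 logn hB hS *.
have CL : 28 + 8 * C <= (28 + 8 * C) * (2 * L) by rewrite ler_peMr//; lra.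
have K1L : 0 <= K1 * L by rewrite mulr_ge0//; lra.
have K2L : 0 <= K2 * L by rewrite mulr_ge0//; lra.
have CL0 : 0 <= C * L by rewrite mulr_ge0//; lra.
split; apply: le_trans logn; first by rewrite /K; move: hB hS CL; lra.
rewrite /converse_err -/B -/L.
have -> : 4 / n%:R * (2 * (1 + n%:R * (1 + C) + B)) = 8 * (1 + C) + 8 * ((1 + B) / n%:R).
  by field; rewrite gt_eqF.
have : (1 + B) / n%:R <= 1 + B by rewrite ler_pdivrMr// ler_peMr//; lra.
by rewrite /K; move: hB CL; lra.
Qed.

Lemma ae_nT {R : realType} {d : measure_display} {TY : measurableType d}
    (PY : probability TY R) n (Q : n.-tuple TY -> Prop) : (forall ys, Q ys) -> ae_n PY Q.
Proof.
move=> hQ; exists set0; split => //; last by move=> ys /= /(_ (hQ ys)).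
rewrite -[RHS](iint_cst PY n 0); congr (iint PY).
by apply/funext => ys; rewrite indic0.
Qed.

Theorem theorem1 (R : realType) (d : measure_display) (TY : measurableType d)
    (PY : probability TY R) (p : nat -> TY -> R)
    (hp : cond_pmf p)
    (ha : exists c : R, 0 < c /\ \forall y \ae PY, (c%:E <= condV p y)%E)
    (hb : exists C : R, \forall y \ae PY, (condT p y <= C%:E)%E) :
  forall eps : R, 0 <= eps <= 1 ->
  exists (K : R) (N : nat), forall n : nat, (N <= n)%N ->
    let main := ((n%:R * (1 - eps))%:E * Hc PY p
                 - (Num.sqrt (n%:R * fine (Vc PY p)) * fG eps)%:E)%E in
    (Lstar_max PY p n eps <= main + (K * log2 (n%:R : R))%:E)%E /\
    (main - (K * log2 (n%:R : R))%:E <= Lstar_max PY p n eps)%E.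
Proof.
move=> eps eps01; have [c [c0 hc]] := ha; have [C' hC'] := hb.
pose C := Num.max 0 C'; have C0 : 0 <= C by rewrite le_max lexx.
have reg : \forall y \ae PY, regular p c C y.
  apply: filterS2 hc hC' => y h1 h2; split => //.
  by rewrite (le_trans h2)// lee_fin le_max lexx orbT.
have [_ /andP[cm _]] := integral_vari hp c0 C0 reg.
set m := fine (Vc PY p) in cm *.
have [K hK] := error_terms_log c0 C0 (lt_le_trans c0 cm).
exists K, 4%N => n n4 /=; have [hK1 hK2] := hK n n4.
set S := Num.sqrt _ * _; set X := (_ * Hc PY p)%E.
have X0 : (0 <= X)%E.
  have /andP[_ e1] := eps01.
  rewrite mule_ge0 ?lee_fin ?mulr_ge0 ?subr_ge0//.
  by apply: integral_ge0 => y _; exact: condH_ge0.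
split.
  have ach := achievability_integrated hp c0 C0 reg n eps01.
  have [code err] := block_code hp n eps01.
  rewrite -/m -/S -/X in ach.
  set EL := exp_len PY p _ in ach.
  have EL0 : (0 <= EL)%E.
    apply: iint_ge0 => ys; apply: esum_ge0 => xs _; apply: esum_ge0 => b _.
    by have [[e0 _ _] _] := code; rewrite lee_fin !mulr_ge0// pn_ge0.
  (* If the entropy term is infinite, the upper bound is +oo and there is nothing to prove. *)
  move: X X0 ach => [x||]// x0 ach; last by rewrite /= leey.
  rewrite -EFinB -EFinD in ach *.
  move: ach; rewrite -leeBrDr// -EFinB => ach.
  have x1 := le_trans EL0 ach; rewrite lee_fin in x1.
  (* Admissible lengths are strictly positive; the spare 1 in the first bound of [error_terms_log]
     guarantees this. *)
  apply: ereal_inf_lbound; exists (x - S + K * log2 n%:R) => //; split.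
    by move: x1 hK1; lra.
  exists (block_enc p eps), (@block_dec _ _ _ p n); split => //.
    by apply: (le_trans ach); rewrite lee_fin; move: hK1; lra.
  exact: ae_nT.
apply/ereal_infP => _ [L [L0 [enc [dec [code len err]]]] <-].
have conv := converse_integrated hp c0 C0 reg n4 eps01 code err.
rewrite -/m -/S -/X in conv.
rewrite -addeA -EFinD -opprD EFinN leeBlDr// (le_trans conv)//.
apply: (le_trans (leeD2r _ len)).
by rewrite -!EFinD lee_fin; move: hK2; lra.
Qed.
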